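(* Suppose the power injections follow the Ornstein-Uhlenbeck model with common mean-reversion rate $\gamma>0$, i.e. for every $\mu\in\mathbb R^m$ one has $b_i(x)=\gamma(\mu_i-x)$ and $l_i(x)=l_i>0$ constant for $i=1,\dots,m$; put $\mathsf L=\mathrm{diag}(l_1,\dots,l_m)$ and $M_T=\gamma^{-1}(1-e^{-2\gamma T})\mathsf L^2$. Let $\tau=\tau_0(1,\dots,1)^\top$ with $\tau_0>0$. Then for all $\overline\mu\in\mathcal A$ $$\mathcal I_{\mathrm{tmp},\tau}^{(TL)}(\overline\mu)=(1+2\tau_0\gamma)\,\mathcal I_{\mathrm{cur}}^*(\overline\mu)=(1+2\tau_0\gamma)\min_{\ell\in\mathcal L'}\frac{(1-|\nu_\ell|)^2}{C_\ell M_TC_\ell^\top},$$ and $$\tilde{\mathcal R}^{(\mathrm{tmp},\tau,TL)}_{\epsilon,p}=\bigcap_{\ell\in\mathcal L'}\Bigl\{\overline\mu\in\mathcal A:\ |\nu_\ell|\le1-\frac{\eta_\ell}{\sqrt{1+2\tau_0\gamma}}\Bigr\},$$ where $\eta_\ell=\sqrt{\frac{\epsilon\log(1/p)\,\sigma_\ell^2\,(1-e^{-2\gamma T})}{\gamma}}$ and $\sigma_\ell^2=C_\ell\mathsf L^2C_\ell^\top$.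
   Context: Network. $\mathcal G=(\mathcal N,\mathcal L)$ is a finite connected graph with nodes $\{0,1,\dots,N\}$, arbitrarily oriented edges (lines) $\ell\in\mathcal L$ and weights $w_\ell>0$. $A\in\mathbb R^{|\mathcal L|\times(N+1)}$ is the incidence matrix ($A_{\ell,i}=1$ if $\ell=(i,j)$, $-1$ if $\ell=(j,i)$, $0$ otherwise), $W=\mathrm{diag}(w_\ell)$, $B=A^\top WA$, $\hat B$ is $B$ with the row and column of node $0$ deleted, $\breve B=\begin{pmatrix}0&0\\0&\hat B^{-1}\end{pmatrix}$, $\Lambda=\mathrm{diag}(1/I_{\ell,\max})$ with constants $I_{\ell,\max}>0$, and $\overline C=\Lambda WA\breve B$. Fix $1\le m\le N$; $C$ consists of columns $1,\dots,m$ of $\overline C$ and $C_D$ of columns $m+1,\dots,N$. The matrix $C$ has linearly independent columns; $C^+=(C^\top C)^{-1}C^\top$ is its Moore-Penrose inverse, with $i$-th row $C_i^+$. For $\overline\mu=(\mu,\mu_D)\in\mathbb R^m\times\mathbb R^{N-m}=\mathbb R^N$ put $y=C_D\mu_D$ and $\nu=C\mu+y$. $C_\ell$ is the $\ell$-th row of $C$ and $\mathcal L'=\{\ell\in\mathcal L: C_\ell\ne0\}$. Admissible initial conditions. $\mathcal A=\{\overline\mu\in\mathbb R^N: |\nu_\ell|\le1 \text{ for all } \ell\in\mathcal L,\ |\nu_\ell|<1\text{ for all }\ell\notin\mathcal L'\}$. Rate functions. $T>0$. $H^1_\mu$ is the set of $g:[0,T]\to\mathbb R^m$ with $g(t)=\mu+\int_0^t\phi(s)\,ds$,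 $\phi\in L_2([0,T])$. For $g\in H^1_\mu$, $\mathcal I_{\mathrm{pow}}(g)=\sum_{i=1}^m\frac12\int_0^T\left(\frac{g_i'-b_i(g_i)}{l_i(g_i)}\right)^2dt$. For $f\in y+CH^1_\mu$, $\mathcal I_{\mathrm{cur}}(f)=\mathcal I_{\mathrm{pow}}(C^+(f-y))$. For continuous $f:[0,T]\to\mathbb R^{|\mathcal L|}$, $\|f\|_\infty=\max_{t\in[0,T]}\max_\ell|f_\ell(t)|$. $\mathcal I_{\mathrm{cur}}^*(\overline\mu)=\inf\{\mathcal I_{\mathrm{cur}}(f): f\in y+CH^1_\mu,\ \|f\|_\infty\ge1\}$. Taylor approximation. Let $f_*$ be an optimal current path to overflow, i.e. a minimizer of $\mathcal I_{\mathrm{cur}}$ over $\{f\in y+CH^1_\mu:\|f\|_\infty\ge1\}$ (if there are several, any one of them). Put $K_i(f_*(t),f_*'(t))=\frac12\left(\frac{C_i^+f_*'(t)-b_i(C_i^+(f_*(t)-y))}{l_i(C_i^+(f_*(t)-y))}\right)^2$, $\Phi_{f_*}=\sum_{i=1}^m\bigl[K_i(f_*(T),f_*'(T))-K_i(f_*(0),f_*'(0))\bigr]$ (with one-sided derivatives at the endpoints), and, for $\tau=\tau_0(1,\dots,1)^\top$, $\mathcal I_{\mathrm{tmp},\tau}^{(TL)}(\overline\mu)=\mathcal I_{\mathrm{cur}}^*(\overline\mu)+\tau_0\Phi_{f_*}$. For $\epsilon>0$ and $p\in(0,1)$, $\tilde{\mathcal R}^{(\mathrm{tmp},\tau,TL)}_{\epsilon,p}=\{\overline\mu\in\mathcal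 A:\mathcal I_{\mathrm{tmp},\tau}^{(TL)}(\overline\mu)\ge-\epsilon\log p\}$. *)

(* Defs.v *)
From HB Require Import structures.
From mathcomp Require Import all_boot all_order all_algebra.
From mathcomp Require Import all_classical all_reals all_analysis.
Set Implicit Arguments.
Unset Strict Implicit.
Unset Printing Implicit Defensive.
Import Order.TTheory GRing.Theory Num.Theory.
Import numFieldNormedType.Exports.
Local Open Scope classical_set_scope.
Local Open Scope ring_scope.

(** Nodes are ['I_n.+1], with [ord0] as the slack node [0].  Each line is an
    oriented pair of nodes; since the underlying graph is simple, no node is
    joined to itself and no two lines have the same pair of endpoints,
    whatever their orientations. *)
Record network (R : realType) (n : nat) := Network {
  nlines : nat;
  line : 'I_nlines -> 'I_n.+1 * 'I_n.+1;
  weight : 'I_nlines -> R;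
  imax : 'I_nlines -> R;
  line_loopless : forall l, (line l).1 != (line l).2;
  line_simple : forall l l',
    line l' = line l \/ line l' = ((line l).2, (line l).1) -> l' = l;
  line_connected : forall i j : 'I_n.+1,
    connect (fun i j => [exists l, (line l == (i, j)) || (line l == (j, i))])
            i j;
  weight_gt0 : forall l, 0 < weight l;
  imax_gt0 : forall l, 0 < imax l }.

Section NetworkMatrices.
Variables (R : realType) (n : nat) (G : network R n).
Local Notation E := (nlines G).

Definition incidence : 'M[R]_(E, n.+1) := \matrix_(l, i)
  if (line l).1 == i then 1 else if (line l).2 == i then -1 else 0.

Definition Wmx : 'M[R]_E := diag_mx (\row_l weight l).

Definition laplacian : 'M[R]_(n.+1) := incidence^T *m Wmx *m incidence.

Definition red_laplacian : 'M[R]_n := row' ord0 (col' ord0 laplacian).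

Definition breveB : 'M[R]_(1 + n) := block_mx 0 0 0 (invmx red_laplacian).

Definition Lambda : 'M[R]_E := diag_mx (\row_l (imax l)^-1).

(* The columns are indexed by all the nodes; the column of node 0 is null. *)
Definition Cbar : 'M[R]_(E, 1 + n) := Lambda *m Wmx *m incidence *m breveB.

End NetworkMatrices.

(** The non-slack nodes [1, ..., N] are split as [N = m + d]: the first [m]
    carry stochastic injections, the last [d] deterministic ones. *)
Section Currents.
Variables (R : realType) (m d : nat) (G : network R (m + d)).
Local Notation E := (nlines G).

Definition Cmx : 'M[R]_(E, m) := lsubmx (rsubmx (Cbar G)).
Definition CDmx : 'M[R]_(E, d) := rsubmx (rsubmx (Cbar G)).

Definition Cplus : 'M[R]_(m, E) := invmx (Cmx^T *m Cmx) *m Cmx^T.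

Definition det_current (mubar : 'cV[R]_(m + d)) : 'cV[R]_E :=
  CDmx *m dsubmx mubar.

Definition nu (mubar : 'cV[R]_(m + d)) : 'cV[R]_E :=
  Cmx *m usubmx mubar + det_current mubar.

Definition Lprime : set 'I_E := [set l | row l Cmx != 0].

Definition admissible : set 'cV[R]_(m + d) :=
  [set mubar | (forall l, `|nu mubar l ord0| <= 1) /\
               (forall l, ~ Lprime l -> `|nu mubar l ord0| < 1)].

End Currents.

Arguments Lprime {R m d} G _.

(** Paths on [[0, T]] are functions on [R] of which only the values on
    [[0, T]] matter. *)
Section Paths.
Variable R : realType.
Local Notation leb := (@lebesgue_measure R).

Definition L2fun (T : R) (phi : R -> R) : Prop :=
  measurable_fun `[0, T] phi /\
  (\int[leb]_(t in `[0%R, T]) ((phi t) ^+ 2)%:E < +oo)%E.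

Definition H1 (T : R) k (mu : 'cV[R]_k) : set (R -> 'cV[R]_k) :=
  [set g : R -> 'cV[R]_k | exists2 phi : R -> 'cV[R]_k,
     forall i, L2fun T (fun s => phi s i ord0) &
     forall t : R, t \in `[0, T] -> forall i,
       g t i ord0 = mu i ord0 + \int[leb]_(s in `[0, t]) phi s i ord0].

Definition sup_norm (T : R) k (f : R -> 'cV[R]_k) : R :=
  sup [set \big[Num.max/0]_(l < k) `|f t l ord0| | t in `[0, T]].

Definition diff_quotient k (f : R -> 'cV[R]_k) (t : R) (l : 'I_k) (h : R) : R :=
  h^-1 * (f (t + h) l ord0 - f t l ord0).

Definition rderive k (f : R -> 'cV[R]_k) (t : R) : 'cV[R]_k :=
  \col_l lim (diff_quotient f t l h @[h --> 0^'+]).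

Definition lderive k (f : R -> 'cV[R]_k) (t : R) : 'cV[R]_k :=
  \col_l lim (diff_quotient f t l h @[h --> 0^'-]).

Definition endpoint_derivable (T : R) k (f : R -> 'cV[R]_k) : Prop :=
  forall l, cvg (diff_quotient f 0 l h @[h --> 0^'+]) /\
            cvg (diff_quotient f T l h @[h --> 0^'-]).

(* The integrand involves the pointwise derivative of [g], which for a path
   in [H1] exists almost everywhere and is the density [phi]. *)
Definition Ipow (T : R) m (b l : 'I_m -> R -> R) (g : R -> 'cV[R]_m) : \bar R :=
  (\sum_(i < m) (2^-1)%:E * \int[leb]_(t in `[0%R, T])
     (((derive1 (fun s => g s i ord0) t - b i (g t i ord0)) / l i (g t i ord0))
        ^+ 2)%:E)%E.

End Paths.

(** [b] and [l] are the drift and diffusion coefficients of the injections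
    started at [usubmx mubar]. *)
Section Currents.
Variables (R : realType) (m d : nat) (G : network R (m + d)) (T : R).
Variables (b l : 'I_m -> R -> R).
Local Notation E := (nlines G).

Definition cur_paths (mubar : 'cV[R]_(m + d)) : set (R -> 'cV[R]_E) :=
  [set f : R -> 'cV[R]_E | exists2 g, H1 T (usubmx mubar) g &
     forall t : R, t \in `[0, T] -> f t = det_current G mubar + Cmx G *m g t].

Definition Icur (mubar : 'cV[R]_(m + d)) (f : R -> 'cV[R]_E) : \bar R :=
  Ipow T b l (fun t => Cplus G *m (f t - det_current G mubar)).

Definition overflow_paths (mubar : 'cV[R]_(m + d)) : set (R -> 'cV[R]_E) :=
  [set f | cur_paths mubar f /\ 1 <= sup_norm T f].

Definition Icur_star (mubar : 'cV[R]_(m + d)) : \bar R :=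
  ereal_inf (Icur mubar @` overflow_paths mubar).

Definition optimal_path (mubar : 'cV[R]_(m + d)) (f : R -> 'cV[R]_E) : Prop :=
  overflow_paths mubar f /\
  forall h, overflow_paths mubar h -> (Icur mubar f <= Icur mubar h)%E.

Definition Kcost (mubar : 'cV[R]_(m + d)) (i : 'I_m) (x v : 'cV[R]_E) : R :=
  let xi := (Cplus G *m (x - det_current G mubar)) i ord0 in
  2^-1 * (((Cplus G *m v) i ord0 - b i xi) / l i xi) ^+ 2.

Definition Phi (mubar : 'cV[R]_(m + d)) (f : R -> 'cV[R]_E) : R :=
  \sum_(i < m) (Kcost mubar i (f T) (lderive f T)
                - Kcost mubar i (f 0) (rderive f 0)).

(* [f] stands for the chosen optimal path from [mubar]. *)
Definition I_TL (tau0 : R) (mubar : 'cV[R]_(m + d)) (f : R -> 'cV[R]_E)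
    : \bar R :=
  (Icur_star mubar + (tau0 * Phi mubar f)%:E)%E.

End Currents.

Section Region.
Variables (R : realType) (m d : nat) (G : network R (m + d)) (T : R).
(* The coefficients may depend on the initial value [mu]. *)
Variables (b : 'cV[R]_m -> 'I_m -> R -> R) (l : 'cV[R]_m -> 'I_m -> R -> R).

(* A choice of one optimal path to overflow for each admissible [mubar]. *)
Definition optimal_choice
    (fstar : 'cV[R]_(m + d) -> R -> 'cV[R]_(nlines G)) : Prop :=
  forall mubar, admissible G mubar ->
    optimal_path T (b (usubmx mubar)) (l (usubmx mubar)) mubar (fstar mubar).

Definition region_TL (fstar : 'cV[R]_(m + d) -> R -> 'cV[R]_(nlines G))
    (tau0 eps p : R) : set 'cV[R]_(m + d) :=
  [set mubar | admissible G mubar /\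
     ((- eps * ln p)%:E <=
        I_TL T (b (usubmx mubar)) (l (usubmx mubar)) tau0 mubar
             (fstar mubar))%E].

End Region.

Arguments optimal_choice {R m d} G T b l fstar.
Arguments region_TL {R m d} G T b l fstar tau0 eps p _.

Section OrnsteinUhlenbeck.
Variables (R : realType) (m d : nat) (G : network R (m + d)) (T gamma : R).
Variable lc : 'I_m -> R.

Definition Lmx : 'M[R]_m := diag_mx (\row_i lc i).

Definition MT : 'M[R]_m :=
  (gamma^-1 * (1 - expR (- (2 * gamma * T)))) *: (Lmx *m Lmx).

Definition line_var (k : 'I_(nlines G)) : R :=
  (row k (Cmx G) *m MT *m (row k (Cmx G))^T) ord0 ord0.

Definition sigma2 (k : 'I_(nlines G)) : R :=
  (row k (Cmx G) *m (Lmx *m Lmx) *m (row k (Cmx G))^T) ord0 ord0.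

Definition eta (eps p : R) (k : 'I_(nlines G)) : R :=
  Num.sqrt (eps * ln (1 / p) * sigma2 k * (1 - expR (- (2 * gamma * T)))
            / gamma).

End OrnsteinUhlenbeck.

(* Main.v *)
Require Import Defs.
From mathcomp Require Import all_boot all_order all_algebra.
From mathcomp Require Import all_classical all_reals all_analysis.
From mathcomp Require Import measurable_realfun ring lra.
Set Implicit Arguments.
Unset Strict Implicit.
Unset Printing Implicit Defensive.
Import Order.TTheory GRing.Theory Num.Theory.
Import numFieldNormedType.Exports.
Local Open Scope classical_set_scope.
Local Open Scope ring_scope.

(* A path g = mu + x has rate sum_i |u_i|^2 / (2 l_i^2) with
   u_i = x_i' + gamma x_i in L^2, and variation of constants gives
   e^(gamma t) x_i(t) = int_0^t e^(gamma s) u_i(s) ds.  Cauchy-Schwarz, obtained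
   by completing the square against the control s |-> theta l_i^2 C_ki
   e^(gamma s), bounds (C_k x(t))^2 by the rate times
   gamma^-1 (1 - e^(-2 gamma t)) sigma_k^2.  Overflow of line k at time t forces
   |C_k x(t)| >= 1 - |nu_k|, and the bound increases with t, so the cheapest
   overflow happens at time T.  In the equality case u_i is a.e. a multiple of
   e^(gamma s), hence every optimal path is x_i(t) = c_i sinh(gamma t) / gamma;
   for these paths Phi is 2 gamma times the rate. *)

(** * Integration by parts against a Lebesgue primitive *)

(** Two features of the cost shape the argument. The rate integrates an expression in the pointwise
    derivative, which agrees with the density only almost everywhere and gives an integrand not
    known to be measurable. So a general path receives only a lower bound, and the rate is evaluated
    exactly on the explicit sinh paths alone; the two meet at the minimum. Next, [Phi] reads
    one-sided derivatives at [0] and [T], which a path in [H1] need not have. Knowing the value of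
    the infimum is therefore not enough: every minimizer must be identified on all of [[0, T]]. This
    is why Cauchy-Schwarz is done by completing the square: the deficit stays visible as the
    integral of [(u - c e)^2], and its vanishing determines the path. On a sinh path the running
    cost [K] is proportional to [e^(2 gamma t)], so [K' = 2 gamma K], and the increment of [K] over
    [[0, T]] is [2 gamma] times its integral; this is the source of the factor [1 + 2 tau0 gamma]. A
    line that starts at capacity needs separate care: its cost is zero and its overflow time is not
    forced to be [T]. *)

Section IntegrationByParts.
Variable R : realType.
Local Notation leb := (@lebesgue_measure R).

Lemma integrable_prod (h k : R -> R) :
  leb.-integrable setT (EFin \o h) -> leb.-integrable setT (EFin \o k) ->
  (leb \x leb)%E.-integrable setT (fun z : R * R => (h z.1 * k z.2)%:E).
Proof.
move=> ih ik.
have mh : measurable_fun setT h by apply/measurable_EFinP; exact: measurable_int ih.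
have mk : measurable_fun setT k by apply/measurable_EFinP; exact: measurable_int ik.
apply/integrable12ltyP.
  apply/measurable_EFinP; apply: measurable_funM.
    exact: measurableT_comp.
  exact: measurableT_comp.
have -> : (fun x : R => \int[leb]_y `|(h (x, y).1 * k (x, y).2)%:E|)%E =
   (fun x => `|h x|%:E * \int[leb]_y `|(k y)%:E|)%E.
  apply/funext => x /=.
  rewrite -ge0_integralZl//.
  - by apply: eq_integral => y _; rewrite -EFinM normrM.
  - apply/measurable_EFinP; exact: measurableT_comp.
have ikf : (\int[leb]_y `|(k y)%:E|)%E \is a fin_num.
  exact: integrable_fin_num (integrable_abse ik).
under eq_integral do rewrite muleC.
rewrite ge0_integralZl//.
- apply: lte_mul_pinfty; [|exact: ikf|]; first by apply: integral_ge0 => y _; exact: abse_ge0.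
  by have /integrableP[] := ih.
- apply/measurable_EFinP; exact: measurableT_comp.
- by apply: integral_ge0 => y _; exact: abse_ge0.
Qed.

Lemma EFin_Rintegral D (f : R -> R) : measurable D ->
  leb.-integrable D (EFin \o f) ->
  (\int[leb]_(x in D) f x)%:E = (\int[leb]_(x in D) (f x)%:E)%E.
Proof. by move=> mD fi; rewrite fineK//; exact: integrable_fin_num fi. Qed.

(** Fubini for [k s * phi r] on the triangle [0 <= r <= s <= t]: integrating over [r] first gives
    the left side, over [s] first the right side. Only integrability of [phi] is asked for, so the
    primitive need not be differentiable anywhere in particular. *)
Lemma Rintegral_primitive_parts (phi K k : R -> R) (t : R) : 0 <= t ->
  continuous k -> (forall s : R, is_derive s (1 : R) K (k s)) ->
  leb.-integrable `[0, t] (EFin \o phi) ->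
  \int[leb]_(s in `[0, t]) (k s * \int[leb]_(r in `[0, s]) phi r) =
  \int[leb]_(r in `[0, t]) (phi r * (K t - K r)).
Proof.
move=> t0 ck dK iphi.
have cK : continuous K.
  by move=> x; apply/differentiable_continuous/derivable1_diffP; have [] := dK x.
have ikt : leb.-integrable `[0, t] (EFin \o k).
  apply: continuous_compact_integrable; first exact: segment_compact.
  exact: continuous_subspaceT.
pose h := k \_ `[0, t]; pose f := phi \_ `[0, t].
have ih : leb.-integrable setT (EFin \o h).
  by rewrite /h -restrict_EFin; apply/integrable_restrict => //=; rewrite setTI.
have jf : leb.-integrable setT (EFin \o f).
  by rewrite /f -restrict_EFin; apply/integrable_restrict => //=; rewrite setTI.
pose F (z : R * R) : \bar R := (h z.1 * f z.2 * \1_[set z : R * R | z.2 <= z.1] z)%:E.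
have mle : measurable [set z : R * R | z.2 <= z.1].
  rewrite -[X in measurable X]setTI.
  exact: measurable_fun_le.
have iF : (leb \x leb)%E.-integrable setT F.
  apply: le_integrable (integrable_prod ih jf) => //.
    apply/measurable_EFinP; apply: measurable_funM => //.
    by apply/measurable_EFinP; exact: measurable_int (integrable_prod ih jf).
  move=> z _; rewrite /F/= normrM lee_fin indicE.
  by case: (_ \in _); rewrite ?normr1 ?normr0 ?mulr1 ?mulr0.
have := Fubini iF.
have -> : (\int[leb]_x \int[leb]_y F (x, y))%E =
  (\int[leb]_(s in `[0%R, t]) (k s * \int[leb]_(r in `[0, s]) phi r)%R%:E)%E.
  rewrite [RHS]integral_mkcond; apply: eq_integral => s _.
  rewrite patchE; case: ifPn => [|st]; last first.
    rewrite integral0_eq// => y _; rewrite /F/= /h patchE (negbTE st).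
    by rewrite !mul0r.
  rewrite inE/= in_itv/= => /andP[s0 st].
  rewrite EFinM EFin_Rintegral//; last first.
    apply: integrableS iphi => //=; by apply: subset_itvl; rewrite bnd_simp.
  rewrite [in RHS]integral_mkcond -integralZl//; last first.
    apply/integrable_restrict => //=; rewrite setTI.
    apply: integrableS iphi => //=; by apply: subset_itvl; rewrite bnd_simp.
  apply: eq_integral => r _; rewrite /F/= /h /f !patchE !mem_setE !in_itv/= s0 st/=.
  rewrite indicE; case: (leP 0 r) => r0 /=; last by rewrite mulr0 mul0r mule0.
  case: (leP r s) => rs.
    by rewrite (le_trans rs st) mem_set// mulr1 EFinM.
  rewrite memNset/= ?mulr0 ?mule0//.
  by apply/negP; rewrite -ltNge.
have -> : (\int[leb]_y \int[leb]_x F (x, y))%E =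
  (\int[leb]_(r in `[0%R, t]) (phi r * (K t - K r))%R%:E)%E.
  rewrite [RHS]integral_mkcond; apply: eq_integral => r _.
  rewrite patchE; case: ifPn => [|rt]; last first.
    rewrite integral0_eq// => y _; rewrite /F/= /f patchE (negbTE rt).
    by rewrite mulr0 mul0r.
  rewrite inE/= in_itv/= => /andP[r0 rt].
  rewrite EFinM.
  have -> : (K t - K r)%:E = (\int[leb]_(s in `[r, t]) (k s)%:E)%E.
    move: rt; rewrite le_eqVlt => /predU1P[->|rt].
      by rewrite subrr set_itv1 integral_set1.
    rewrite (@continuous_FTC2 _ k K)//.
    - exact: continuous_subspaceT.
    - split.
      + by move=> x _; have [] := dK x.
      + exact/cvg_at_right_filter/cK.
      + exact/cvg_at_left_filter/cK.
    - by move=> x _; rewrite derive1E; apply: derive_val.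
  have ikr : leb.-integrable `[r, t] (EFin \o k).
    by apply: integrableS ikt => //=; apply: subset_itvr; rewrite bnd_simp.
  rewrite [in RHS]integral_mkcond -integralZl//; last first.
    by apply/integrable_restrict => //=; rewrite setTI.
  apply: eq_integral => s _; rewrite /F/= /h /f !patchE !mem_setE !in_itv/= r0 rt/=.
  rewrite indicE; case: (leP r s) => rs /=; last first.
    rewrite memNset/= ?mulr0 ?mule0//.
    by apply/negP; rewrite -ltNge.
  rewrite mem_set// mulr1 (le_trans r0 rs)/=.
  by case: ifP => _; rewrite ?mul0r ?mule0// mulrC EFinM.
by rewrite /Rintegral => ->.
Qed.

End IntegrationByParts.

(** * The scalar Ornstein-Uhlenbeck energy *)

Section EFinIntegrable.
Context d (X : measurableType d) (R : realType) (mu : {measure set X -> \bar R}).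
Variables (D : set X) (mD : measurable D).
Implicit Types f g : X -> R.

Lemma integrable_EFinD f g :
  mu.-integrable D (EFin \o f) -> mu.-integrable D (EFin \o g) ->
  mu.-integrable D (EFin \o (fun t => f t + g t)).
Proof. by move=> fi gi; exact: (integrableD mD fi gi). Qed.

Lemma integrable_EFinB f g :
  mu.-integrable D (EFin \o f) -> mu.-integrable D (EFin \o g) ->
  mu.-integrable D (EFin \o (fun t => f t - g t)).
Proof. by move=> fi gi; exact: (integrableB mD fi gi). Qed.

Lemma integrable_EFinZl (c : R) f :
  mu.-integrable D (EFin \o f) -> mu.-integrable D (EFin \o (fun t => c * f t)).
Proof. by move=> fi; exact: (integrableZl mD c fi). Qed.

End EFinIntegrable.

(** * Square-integrable functions on a bounded interval *)

Section SquareIntegrable.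
Variables (R : realType) (T : R).
Local Notation leb := (@lebesgue_measure R).
Implicit Types f g : R -> R.

Lemma L2fun_sqr_integrable f : L2fun T f ->
  leb.-integrable `[0, T] (EFin \o (fun t => f t ^+ 2)).
Proof.
move=> [mf f2]; apply/integrableP; split.
  by apply/measurable_EFinP; exact: measurable_funX.
rewrite (_ : (\int[leb]_(x in _) _)%E = (\int[leb]_(t in `[0%R, T]) ((f t) ^+ 2)%:E)%E)//.
by apply: eq_integral => x _ /=; rewrite ger0_norm// sqr_ge0.
Qed.

Lemma L2funM_integrable f g : L2fun T f -> L2fun T g ->
  leb.-integrable `[0, T] (EFin \o (fun t => f t * g t)).
Proof.
move=> Lf Lg.
have : leb.-integrable `[0, T] (EFin \o (fun t => f t ^+ 2 + g t ^+ 2)).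
  by apply: integrable_EFinD => //; exact: L2fun_sqr_integrable.
apply: le_integrable => //.
- by apply/measurable_EFinP; apply: measurable_funM; [case: Lf|case: Lg].
- move=> x _ /=; rewrite lee_fin normrM [leRHS]ger0_norm ?addr_ge0 ?sqr_ge0//.
  rewrite -[in leRHS](real_normK (num_real (f x))) -[in leRHS](real_normK (num_real (g x))).
  have := sqr_ge0 (`|f x| - `|g x|); have := normr_ge0 (f x); have := normr_ge0 (g x).
  set a := `|f x|; set b := `|g x|; nra.
Qed.

Lemma continuous_L2fun f : {within `[0, T], continuous f} -> L2fun T f.
Proof.
move=> cf; split; first exact: subspace_continuous_measurable_fun.
have : leb.-integrable `[0, T] (EFin \o (fun t => f t ^+ 2)).
  apply: continuous_compact_integrable; first exact: segment_compact.
  by move=> x; apply: cvgM; exact: cf.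
by apply: integrable_lty.
Qed.

Lemma L2fun_integrable f : L2fun T f -> leb.-integrable `[0, T] (EFin \o f).
Proof.
move=> Lf; have L1 : L2fun T (cst 1).
  by apply: continuous_L2fun; by apply: continuous_subspaceT => x; exact: cvg_cst.
by apply: eq_integrable (L2funM_integrable Lf L1) => // x _ /=; rewrite mulr1.
Qed.

Lemma L2funD f g : L2fun T f -> L2fun T g -> L2fun T (fun t => f t + g t).
Proof.
move=> Lf Lg; split; first by apply: measurable_funD; [case: Lf|case: Lg].
have : leb.-integrable `[0, T] (EFin \o (fun t => (f t ^+ 2 + g t ^+ 2) + (f t * g t + f t * g t))).
  apply: integrable_EFinD => //.
    by apply: integrable_EFinD => //; exact: L2fun_sqr_integrable.
  by apply: integrable_EFinD => //; exact: L2funM_integrable.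
move=> iH; apply: le_lt_trans (integrable_lty _ iH) => //.
rewrite le_eqVlt; apply/orP; left; apply/eqP/eq_integral => x _.
by congr EFin; ring.
Qed.

Lemma L2funZ c f : L2fun T f -> L2fun T (fun t => c * f t).
Proof.
move=> Lf; split; first by apply: measurable_funM => //; case: Lf.
have : leb.-integrable `[0, T] (EFin \o (fun t => c ^+ 2 * f t ^+ 2)).
  by apply: integrable_EFinZl => //; exact: L2fun_sqr_integrable.
move=> iH; apply: le_lt_trans (integrable_lty _ iH) => //.
rewrite le_eqVlt; apply/orP; left; apply/eqP/eq_integral => x _.
by rewrite exprMn.
Qed.

End SquareIntegrable.

Section ExpRM.
Variable R : realType.

Lemma is_derive_expRMl (k s : R) :
  is_derive s (1 : R) (fun t => expR (k * t)) (k * expR (k * s)).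
Proof. by apply: is_derive_eq; rewrite scaler1 mulrC. Qed.

Lemma continuous_expRMl (k : R) : continuous (fun t => expR (k * t)).
Proof.
move=> s; apply: (@continuous_comp _ _ _ (fun t => k * t)).
  exact: mulrl_continuous.
exact: continuous_expR.
Qed.

End ExpRM.

Section ScalarOU.
Variables (R : realType) (T gamma : R) (phi : R -> R).
Hypotheses (T0 : 0 < T) (gamma0 : 0 < gamma) (Lphi : L2fun T phi).
Local Notation leb := (@lebesgue_measure R).

Let x t := \int[leb]_(s in `[0, t]) phi s.
Let u t := phi t + gamma * x t.
Let e t := expR (gamma * t).

Let subT t : t \in `[0, T] -> [set` `[0, t]] `<=` [set` `[0, T]].
Proof. by rewrite in_itv/= => /andP[_ tT]; apply: subset_itvl; rewrite bnd_simp. Qed.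

Let intT f t : t \in `[0, T] -> leb.-integrable `[0, T] f ->
  leb.-integrable `[0, t] f.
Proof. by move=> tT; apply: integrableS => //=; exact: subT. Qed.

Lemma L2fun_primitive_continuous : {within `[0, T], continuous x}.
Proof. exact: (parameterized_integral_continuous (ltW T0) (L2fun_integrable Lphi)). Qed.

Let ce : continuous e := @continuous_expRMl R gamma.

Let Le : L2fun T e.
Proof. by apply: continuous_L2fun; exact: continuous_subspaceT. Qed.

Lemma L2fun_OU : L2fun T u.
Proof.
apply: L2funD => //; apply: L2funZ; apply: continuous_L2fun.
exact: L2fun_primitive_continuous.
Qed.

(* Variation of constants for [x' + gamma x = u], [x 0 = 0]. *)
Lemma Rintegral_expR_OU t : t \in `[0, T] ->
  \int[leb]_(s in `[0, t]) (e s * u s) = e t * x t.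
Proof.
move=> tT; have t0 : 0 <= t by move: tT; rewrite in_itv/= => /andP[].
have Lx := continuous_L2fun L2fun_primitive_continuous.
transitivity (\int[leb]_(s in `[0, t]) (e s * phi s + gamma * e s * x s)).
  by apply: eq_Rintegral => s _; rewrite /u; ring.
rewrite RintegralD//; last 2 first.
- by apply: intT => //; exact: L2funM_integrable.
- by apply: intT => //; apply: L2funM_integrable => //; exact: L2funZ.
have iphi := L2fun_integrable Lphi.
have cge : continuous (fun s => gamma * e s).
  by move=> s; apply: cvgM; [exact: cvg_cst|exact: ce].
(* With [K = e] and [k = gamma e], the second integral becomes that of [phi r * (e t - e r)]. Its
   [- e r] part cancels the first integral and leaves [e t * x t]. *)
rewrite (Rintegral_primitive_parts t0 cge (is_derive_expRMl gamma) (intT tT iphi)).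
rewrite -RintegralD//; last 2 first.
- by apply: intT => //; exact: L2funM_integrable.
- apply: intT => //; apply: L2funM_integrable => //.
  apply: continuous_L2fun; apply: continuous_subspaceT => s.
  by apply: cvgB; [exact: cvg_cst|exact: ce].
rewrite -RintegralZl//; last exact: intT.
by apply: eq_Rintegral => s _; rewrite /e; ring.
Qed.

Lemma Rintegral_expR_sqr t : 0 <= t ->
  \int[leb]_(s in `[0, t]) (e s ^+ 2) = (expR (2 * gamma * t) - 1) / (2 * gamma).
Proof.
rewrite le_eqVlt => /predU1P[<-|t0].
  by rewrite set_itv1 Rintegral_set1 mulr0 expR0 subrr mul0r.
have dF (s : R) : is_derive s (1:R) (fun t => (2 * gamma)^-1 * expR (2 * gamma * t)) (e s ^+ 2).
  have D := is_derive_expRMl (2 * gamma) s.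
  have : is_derive s (1:R) ((2 * gamma)^-1 \*: (fun t => expR (2 * gamma * t))) ((2 * gamma)^-1 *: (2 * gamma * expR (2 * gamma * s))).
    exact: is_deriveZ.
  move/is_derive_eq; apply; rewrite /GRing.scale/= mulKf ?mulf_neq0 ?lt0r_neq0//.
  by rewrite /e -expRM_natl; congr expR; ring.
have cF : continuous (fun t => (2 * gamma)^-1 * expR (2 * gamma * t)).
  by move=> s; apply/differentiable_continuous/derivable1_diffP; have [] := dF s.
rewrite /Rintegral (@continuous_FTC2 _ _ (fun t => (2 * gamma)^-1 * expR (2 * gamma * t)))//=.
- by rewrite mulr0 expR0; ring.
- by apply: continuous_subspaceT => s; apply: cvgM; exact: ce.
- split.
  + by move=> s _; have [] := dF s.
  + exact/cvg_at_right_filter/cF.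
  + exact/cvg_at_left_filter/cF.
- by move=> s _; rewrite derive1E; apply: derive_val.
Qed.

Let square_expand c t : t \in `[0, T] ->
  \int[leb]_(s in `[0, t]) ((u s - c * e s) ^+ 2) =
  \int[leb]_(s in `[0, t]) (u s ^+ 2) - 2 * c * (e t * x t)
  + c ^+ 2 * ((expR (2 * gamma * t) - 1) / (2 * gamma)).
Proof.
move=> tT; have t0 : 0 <= t by move: tT; rewrite in_itv/= => /andP[].
have Lu := L2fun_OU.
rewrite -Rintegral_expR_OU// -Rintegral_expR_sqr//.
rewrite -!RintegralZl//; last 2 first.
- by apply: intT => //; exact: L2fun_sqr_integrable.
- by apply: intT => //; exact: L2funM_integrable.
rewrite -RintegralB//; last 2 first.
- by apply: intT => //; exact: L2fun_sqr_integrable.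
- by apply: intT => //; apply: integrable_EFinZl => //; exact: L2funM_integrable.
rewrite -RintegralD//; last 2 first.
- apply: intT => //; apply: integrable_EFinB => //; first exact: L2fun_sqr_integrable.
  by apply: integrable_EFinZl => //; exact: L2funM_integrable.
- by apply: intT => //; apply: integrable_EFinZl => //; exact: L2fun_sqr_integrable.
by apply: eq_Rintegral => s _; ring.
Qed.

(** Expand the nonnegative integral of [(u - c e)^2] over [[0, t]], then enlarge the horizon of the
    energy to [T]. The multiplier [c] stays free because in the vector case it is tuned only after
    summing over the injections. *)
Lemma OU_energy_ge c t : t \in `[0, T] ->
  2 * c * (e t * x t) - c ^+ 2 * ((expR (2 * gamma * t) - 1) / (2 * gamma)) <=
  \int[leb]_(s in `[0, T]) (u s ^+ 2).
Proof.
move=> tT; have Lu := L2fun_OU.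
have le1 : \int[leb]_(s in `[0, t]) (u s ^+ 2) <= \int[leb]_(s in `[0, T]) (u s ^+ 2).
  rewrite -lee_fin !EFin_Rintegral//; last 2 first.
  - exact: L2fun_sqr_integrable.
  - by apply: intT => //; exact: L2fun_sqr_integrable.
  apply: ge0_subset_integral => //=.
  - by apply/measurable_EFinP; apply: measurable_funX; case: Lu.
  - by move=> s _; rewrite lee_fin sqr_ge0.
  - exact: subT.
have : 0 <= \int[leb]_(s in `[0, t]) ((u s - c * e s) ^+ 2).
  by apply: Rintegral_ge0 => s _; exact: sqr_ge0.
rewrite square_expand//; lra.
Qed.

(** The hypothesis makes the integral of [(u - c e)^2] over [[0, T]] vanish, so [u = c e] almost
    everywhere; variation of constants then recovers [x] at every [t], not merely at almost every
    one. *)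
Lemma OU_energy_eq c :
  \int[leb]_(s in `[0, T]) (u s ^+ 2) <=
    2 * c * (e T * x T) - c ^+ 2 * ((expR (2 * gamma * T) - 1) / (2 * gamma)) ->
  forall t, t \in `[0, T] ->
    e t * x t = c * ((expR (2 * gamma * t) - 1) / (2 * gamma)).
Proof.
move=> le1 t tT; have Lu := L2fun_OU.
have t0 : 0 <= t by move: tT; rewrite in_itv/= => /andP[].
have TT : T \in `[0, T] by rewrite in_itv/= lexx ltW.
have z : \int[leb]_(s in `[0, T]) ((u s - c * e s) ^+ 2) = 0.
  apply/eqP; rewrite eq_le; apply/andP; split; last first.
    by apply: Rintegral_ge0 => s _; exact: sqr_ge0.
  by rewrite square_expand//; lra.
have Lw : L2fun T (fun s => u s - c * e s).
  have -> : (fun s => u s - c * e s) = (fun s => u s + (- c) * e s).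
    by apply/funext => s; ring.
  by apply: L2funD => //; exact: L2funZ.
have zae : ae_eq leb [set` `[0, T]] (EFin \o (fun s => (u s - c * e s) ^+ 2)) (cst 0%E).
  apply/ae_eq_integral_abs => //.
    by apply/measurable_EFinP; apply: measurable_funX; case: Lw.
  transitivity (\int[leb]_(s in `[0%R, T]) ((u s - c * e s) ^+ 2)%:E)%E.
    by apply: eq_integral => s _ /=; rewrite ger0_norm// sqr_ge0.
  by rewrite -EFin_Rintegral// ?z//; exact: L2fun_sqr_integrable.
rewrite -Rintegral_expR_OU// -Rintegral_expR_sqr// -RintegralZl//; last first.
  by apply: intT => //; exact: L2fun_sqr_integrable.
congr fine; apply: ae_eq_integral => //.
- apply/measurable_EFinP; apply: measurable_funM.
    by apply: measurable_funS (subT tT) Le.1.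
  by apply: measurable_funS (subT tT) Lu.1.
- apply/measurable_EFinP; apply: measurable_funM => //; apply: measurable_funX.
  by apply: measurable_funS (subT tT) Le.1.
- move: zae; apply: filterS => s /= h st.
  have /eqP := h (subT tT st); rewrite eqe sqrf_eq0 subr_eq0 => /eqP ->.
  by congr EFin; ring.
Qed.

End ScalarOU.

(** * Cost of a scalar path *)

(* Unlike [ge0_le_integral], nothing is assumed measurable here: the pointwise
   derivative of a path is only known to be almost everywhere equal to a
   measurable function. *)
Lemma nonneg_le_integral d (X : measurableType d) (R : realType)
    (mu : {measure set X -> \bar R}) (D : set X) (f g : X -> \bar R) :
  (forall x, D x -> (0 <= f x)%E) -> (forall x, D x -> (f x <= g x)%E) ->
  (\int[mu]_(x in D) f x <= \int[mu]_(x in D) g x)%E.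
Proof.
move=> f0 fg.
have g0 x : D x -> (0 <= g x)%E by move=> Dx; apply: le_trans (f0 _ Dx) (fg _ Dx).
rewrite /integral.
have F0 x : (0 <= (f \_ D) x)%E by apply: erestrict_ge0.
have G0 x : (0 <= (g \_ D) x)%E by apply: erestrict_ge0.
have FG x : ((f \_ D) x <= (g \_ D) x)%E.
  by rewrite !patchE; case: ifPn => // /set_mem; exact: fg.
have pos (h : X -> \bar R) : (forall x, (0 <= h x)%E) -> (h ^\+ = h)%E.
  by move=> h0; apply/funext => x; rewrite (@ge0_funeposE _ _ setT)// inE.
have neg (h : X -> \bar R) : (forall x, (0 <= h x)%E) -> (h ^\- = cst 0)%E.
  by move=> h0; apply/funext => x; rewrite (@ge0_funenegE _ _ setT)// inE.
(* The integral of a nonnegative function is a supremum over the simple functions below it, and more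
   simple functions lie below [g] than below [f]. *)
rewrite (pos _ F0) (pos _ G0) (neg _ F0) (neg _ G0).
apply: leeB => //; apply: ereal_sup_le => _ [h hf <-]; exists h => //.
by move=> x; apply: le_trans (hf x) (FG x).
Qed.

(** Set [f] to zero on the exceptional null set: its integral does not change, and the result lies
    below [g] everywhere. In the application [g] is the cost written with the pointwise derivative,
    so measurability is asked of [f] only. *)
Lemma ae_eq_le_integral d (X : measurableType d) (R : realType)
    (mu : {measure set X -> \bar R}) (D : set X) (f g : X -> \bar R) :
  measurable D -> measurable_fun D f ->
  (forall x, D x -> (0 <= f x)%E) -> (forall x, D x -> (0 <= g x)%E) ->
  ae_eq mu D f g ->
  (\int[mu]_(x in D) f x <= \int[mu]_(x in D) g x)%E.
Proof.
move=> mD mf f0 g0 [N [mN N0 sN]].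
have mC : measurable (~` N) by exact: measurableC.
rewrite (@ae_eq_integral _ _ _ _ _ (f \_ (~` N)))//; last 2 first.
- apply/measurable_restrict => //.
  by apply: measurable_funS mf.
- exists N; split => // x /= h; apply: contrapT => nN; apply: h => Dx.
  by rewrite patchE mem_set.
apply: nonneg_le_integral => x Dx.
  by rewrite patchE; case: ifPn => // _; exact: f0.
rewrite patchE; case: ifPn => [|_]; last exact: g0.
rewrite inE /= => nN; suff -> : f x = g x by [].
by apply: contrapT => fg; apply: nN; apply: sN => /= /(_ Dx).
Qed.

Section ScalarCost.
Variables (R : realType) (T gamma : R).
Hypotheses (T0 : 0 < T) (gamma0 : 0 < gamma).
Local Notation leb := (@lebesgue_measure R).

(** Lebesgue differentiation, applied to [phi] extended by zero. The points [0] and [T] are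
    discarded because [derive1] is two-sided and [G] is unconstrained outside [[0, T]]. *)
Lemma derive1_primitive_ae (phi G : R -> R) (mu : R) : L2fun T phi ->
  (forall t, t \in `[0, T] -> G t = mu + \int[leb]_(s in `[0, t]) phi s) ->
  ae_eq leb [set` `[0, T]] (fun t => derive1 G t) phi.
Proof.
move=> Lphi GE.
pose f := phi \_ `[0, T].
have jf : leb.-integrable setT (EFin \o f).
  rewrite /f -restrict_EFin; apply/integrable_restrict => //=; rewrite setTI.
  exact: L2fun_integrable.
have intf y : leb.-integrable [set` `[0, y]] (EFin \o f) by apply: integrableS jf.
have locf : locally_integrable [set: R] f by apply: open_integrable_locally => //; exact: openT.
have n0 : \forall x \ae leb, x != 0 :> R.
  exists [set 0]; split => //; first by rewrite lebesgue_measure_set1.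
  by move=> x /= /negP; rewrite negbK => /eqP.
have nT : \forall x \ae leb, x != T :> R.
  exists [set T]; split => //; first by rewrite lebesgue_measure_set1.
  by move=> x /= /negP; rewrite negbK => /eqP.
have aeF := FTC1 intf locf.
apply: (@filterS3 _ _ (ae_filter_ringOfSetsType leb) _ _ _ _ _ n0 nT aeF).
move=> t tn0 tnT H tT.
have /andP[t0 tlT] : 0 < t < T.
  by move: tT; rewrite /= in_itv/= => /andP[? ?]; rewrite !lt_neqAle eq_sym tn0 tnT/=; apply/andP.
have [|dF F'] := H. by rewrite /= lte_fin.
have nG : \forall s \near t, mu + (\int[leb]_(r in `[0, s]) f r) = G s.
  near=> s.
  have sT : s \in `[0, T].
    rewrite in_itv/=; apply/andP; split; apply/ltW; near: s.
      exact: lt_nbhsr.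
    exact: lt_nbhsl.
  rewrite GE//; congr (_ + _); apply: eq_Rintegral => r.
  rewrite inE/= => rs; rewrite /f patchE mem_set//=.
  move: rs sT; rewrite !in_itv/= => /andP[-> rs] /andP[_ sT]; exact: le_trans rs sT.
have D : is_derive t (1 : R) (fun s => \int[leb]_(r in `[0, s]) f r) (f t).
  by rewrite derive1E in F'; exact: (DeriveDef dF F').
rewrite derive1E -(near_eq_derive _ nG).
have {}D : is_derive t (1 : R) (cst mu + (fun s => \int[leb]_(r in `[0, s]) f r)) (0 + f t).
  exact: (is_deriveD (is_derive_cst _ _ _) D).
by rewrite derive_val add0r /f patchE mem_set.
Unshelve. all: by end_near. Qed.

Lemma OU_cost_ge (phi G : R -> R) (mu lam : R) : 0 < lam -> L2fun T phi ->
  (forall t, t \in `[0, T] -> G t = mu + \int[leb]_(s in `[0, t]) phi s) ->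
  (((lam ^+ 2)^-1 * \int[leb]_(t in `[0, T])
     ((phi t + gamma * \int[leb]_(s in `[0, t]) phi s) ^+ 2))%:E <=
   \int[leb]_(t in `[0%R, T]) (((derive1 G t - gamma * (mu - G t)) / lam) ^+ 2)%:E)%E.
Proof.
move=> lam0 Lphi GE.
have Lu := L2fun_OU gamma T0 Lphi.
rewrite -RintegralZl//; last exact: L2fun_sqr_integrable.
rewrite EFin_Rintegral//; last first.
  by apply: integrable_EFinZl => //; exact: L2fun_sqr_integrable.
apply: ae_eq_le_integral => //.
- apply/measurable_EFinP; apply: measurable_funM => //; apply: measurable_funX.
  by case: Lu.
- by move=> t _; rewrite lee_fin mulr_ge0 ?invr_ge0 ?sqr_ge0.
- by move=> t _; rewrite lee_fin sqr_ge0.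
- apply: filterS (derive1_primitive_ae Lphi GE) => t h tT.
  rewrite /= h//; congr EFin; rewrite GE//.
  by field; rewrite gt_eqF.
Qed.

(* [OUshape gamma t = sinh (gamma t) / gamma]; the optimal paths are its
   multiples, because [x' + gamma x = exp (gamma t)] for this function. *)
Definition OUshape (t : R) : R := (expR (gamma * t) - expR (- (gamma * t))) / (2 * gamma).
Definition OUshape' (t : R) : R := (expR (gamma * t) + expR (- (gamma * t))) / 2.

Lemma is_derive_OUshape (t : R) : is_derive t (1 : R) OUshape (OUshape' t).
Proof.
have D1 := is_derive_expRMl gamma t.
have D2 : is_derive t (1 : R) (fun t => expR (- (gamma * t))) (- gamma * expR (- (gamma * t))).
  by apply: is_derive_eq; rewrite scaler1 mulrC.
have -> : OUshape = (2 * gamma)^-1 \*: ((fun t => expR (gamma * t)) - (fun t => expR (- (gamma * t)))).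
  by apply/funext => s; rewrite /OUshape mulrC.
apply: is_derive_eq; rewrite /GRing.scale/= /OUshape'.
by field; rewrite gt_eqF.
Qed.

Lemma OUshapeE t : OUshape' t + gamma * OUshape t = expR (gamma * t).
Proof. by rewrite /OUshape /OUshape'; field; rewrite gt_eqF. Qed.

Lemma OUshape0 : OUshape 0 = 0.
Proof. by rewrite /OUshape mulr0 oppr0 subrr mul0r. Qed.

(** The right side is the integral of [e^(2 gamma s)] over [[0, t]], that is, what the equality case
    [u = c e] gives for [e t * x t] when [c = 1]. This identifies the extremal paths as multiples of
    [OUshape]. *)
Lemma expR_OUshape t :
  expR (gamma * t) * OUshape t = (expR (2 * gamma * t) - 1) / (2 * gamma).
Proof.
rewrite /OUshape mulrA mulrBr -expRD -expRD subrr expR0.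
by congr ((expR _ - _) / _); ring.
Qed.

Lemma OUshape_continuous : continuous OUshape.
Proof.
by move=> s; apply/differentiable_continuous/derivable1_diffP; have [] := is_derive_OUshape s.
Qed.

Lemma OUshape'_continuous : continuous OUshape'.
Proof.
move=> s; have -> : OUshape' = (fun t => expR (gamma * t) - gamma * OUshape t).
  by apply/funext => t; rewrite -OUshapeE addrK.
apply: cvgB; last by apply: cvgM; [exact: cvg_cst|exact: OUshape_continuous].
exact: continuous_expRMl.
Qed.

Lemma Rintegral_OUshape' c t : 0 <= t ->
  \int[leb]_(s in `[0, t]) (c * OUshape' s) = c * OUshape t.
Proof.
rewrite le_eqVlt => /predU1P[<-|t0].
  by rewrite set_itv1 Rintegral_set1 OUshape0 mulr0.
have ci : leb.-integrable `[0, t] (EFin \o OUshape').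
  apply: continuous_compact_integrable; first exact: segment_compact.
  by apply: continuous_subspaceT; exact: OUshape'_continuous.
rewrite RintegralZl//; congr (_ * _).
rewrite /Rintegral (@continuous_FTC2 _ _ OUshape)//=.
- by rewrite OUshape0 subr0.
- by apply: continuous_subspaceT; exact: OUshape'_continuous.
- split.
  + by move=> s _; have [] := is_derive_OUshape s.
  + exact/cvg_at_right_filter/OUshape_continuous.
  + exact/cvg_at_left_filter/OUshape_continuous.
- by move=> s _; rewrite derive1E; have D := is_derive_OUshape s; apply: derive_val.
Qed.

(** An equality is possible here because [G] is differentiable at every interior point, which makes
    the integrand explicit and measurable on the open interval; the two endpoints are removed from
    both integrals. *)
Lemma OU_cost_shape (G : R -> R) (mu c lam : R) : 0 < lam ->
  (forall t, t \in `[0, T] -> G t = mu + c * OUshape t) ->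
  (\int[leb]_(t in `[0%R, T]) (((derive1 G t - gamma * (mu - G t)) / lam) ^+ 2)%:E =
   ((c / lam) ^+ 2 * ((expR (2 * gamma * T) - 1) / (2 * gamma)))%:E)%E.
Proof.
move=> lam0 GE.
have Le : L2fun T (fun t => expR (gamma * t)).
  by apply: continuous_L2fun; apply: continuous_subspaceT; exact: continuous_expRMl.
have ie : leb.-integrable `[0, T] (EFin \o (fun s => (c / lam) ^+ 2 * expR (gamma * s) ^+ 2)).
  by apply: integrable_EFinZl => //; exact: L2fun_sqr_integrable.
rewrite -(Rintegral_expR_sqr gamma0 (ltW T0)) -RintegralZl//; last exact: L2fun_sqr_integrable.
rewrite EFin_Rintegral//.
have eqo t : t \in `]0, T[ ->
    ((derive1 G t - gamma * (mu - G t)) / lam) ^+ 2 = (c / lam) ^+ 2 * expR (gamma * t) ^+ 2.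
  rewrite in_itv/= => /andP[t0 tT].
  have nG : \forall s \near t, mu + c * OUshape s = G s.
    near=> s.
    have sT : s \in `[0, T].
      rewrite in_itv/=; apply/andP; split; apply/ltW; near: s.
        exact: lt_nbhsr.
      exact: lt_nbhsl.
    by rewrite GE.
  rewrite derive1E -(near_eq_derive _ nG).
  have D : is_derive t (1 : R) (fun s => mu + c * OUshape s) (c * OUshape' t).
    have D := is_derive_OUshape t.
    have : is_derive t (1:R) (cst mu + c \*: OUshape) (0 + c *: OUshape' t).
      exact: (is_deriveD (is_derive_cst _ _ _) (is_deriveZ c D)).
    by rewrite add0r.
  rewrite derive_val GE; last by rewrite in_itv/= !ltW.
  have <- := OUshapeE t.
  by field; rewrite gt_eqF.
have meas : measurable_fun `]0, T[ (fun t => ((derive1 G t - gamma * (mu - G t)) / lam) ^+ 2).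
  apply: (@eq_measurable_fun _ _ _ _ _ (fun s => (c / lam) ^+ 2 * expR (gamma * s) ^+ 2)).
    by move=> s; rewrite inE/= => sT; rewrite eqo.
  apply: measurable_funS (_ : measurable_fun `[0, T] _) => //; last first.
    by apply/measurable_EFinP; exact: measurable_int ie.
  exact: subset_itv_oo_cc.
rewrite -integral_itv_obnd_cbnd; last first.
  apply/emeasurable_fun_itv_bndo_bndcP; exact/measurable_EFinP.
rewrite -integral_itv_bndo_bndc; last exact/measurable_EFinP.
rewrite -[RHS]integral_itv_obnd_cbnd; last first.
  apply: measurable_funS (measurable_int _ ie) => //.
  by apply: subset_itvr; rewrite bnd_simp.
rewrite -[RHS]integral_itv_bndo_bndc; last first.
  apply: measurable_funS (measurable_int _ ie) => //.
  exact: subset_itv_oo_cc.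
by apply: eq_integral => s; rewrite inE/= => sT; rewrite eqo.
Unshelve. all: by end_near. Qed.

End ScalarCost.

(** * The network matrices *)

Section NetworkAlgebra.
Variable R : realType.

Lemma weighted_gram_eq0 k (w : 'I_k -> R) (v : 'cV[R]_k) :
  (forall l, 0 < w l) -> v^T *m diag_mx (\row_l w l) *m v = 0 -> v = 0.
Proof.
move=> w0 /matrixP/(_ ord0 ord0); rewrite -mulmxA mul_diag_mx !mxE => s0.
have {}s0 : \sum_l w l * v l ord0 ^+ 2 = 0.
  by rewrite -[RHS]s0; apply: eq_bigr => l _; rewrite !mxE; ring.
apply/matrixP => l j; rewrite ord1 mxE; apply/eqP.
move/eqP: s0; rewrite psumr_eq0 => [/allP/(_ l)|i _]; last first.
  by rewrite mulr_ge0 ?sqr_ge0// ltW.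
by rewrite mem_index_enum mulf_eq0 gt_eqF//= sqrf_eq0 => /(_ isT).
Qed.

(** A null row vector [u] of the Gram matrix makes the weighted square norm of [A *m u^T] vanish.
    Applied with the line weights to the reduced Laplacian, and with unit weights to [C^T C]. *)
Lemma gram_unitmx k n (A : 'M[R]_(k, n)) (w : 'I_k -> R) :
  (forall l, 0 < w l) -> (forall v : 'cV[R]_n, A *m v = 0 -> v = 0) ->
  A^T *m diag_mx (\row_l w l) *m A \in unitmx.
Proof.
move=> w0 Ainj; rewrite -row_free_unit; apply: inj_row_free => u u0.
apply: trmx_inj; rewrite trmx0; apply: Ainj; apply: weighted_gram_eq0 w0 _.
by rewrite trmx_mul trmxK !mulmxA; rewrite !mulmxA in u0; rewrite u0 mul0mx.
Qed.

Section Network.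
Variables (n : nat) (G : network R n).
Local Notation A1 := (col' ord0 (incidence G)).

Lemma red_laplacianE :
  red_laplacian G = A1^T *m diag_mx (\row_l weight l) *m A1.
Proof.
apply/matrixP => i j; rewrite !mxE; apply: eq_bigr => l _; rewrite !mxE.
by congr (_ * _); apply: eq_bigr => k _; rewrite !mxE.
Qed.

Lemma incidence_mul (z : 'I_n.+1 -> R) l :
  \sum_i incidence G l i * z i = z (line l).1 - z (line l).2.
Proof.
have ll := @line_loopless _ _ G l.
rewrite (bigD1 (line l).1)//= (bigD1 (line l).2)/=; last by rewrite eq_sym.
rewrite big1 ?addr0.
  by rewrite !mxE !eqxx (negbTE ll) mul1r mulN1r.
move=> i /andP[i1 i2].
by rewrite mxE eq_sym (negbTE i1) eq_sym (negbTE i2) mul0r.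
Qed.

(* A potential without drop along any line is constant, hence null once it
   vanishes at the slack node. *)
Lemma incidence_inj (x : 'cV[R]_n) : A1 *m x = 0 -> x = 0.
Proof.
move=> A0; pose z i := if unlift ord0 i is Some j then x j ord0 else 0.
have z0 : z ord0 = 0 by rewrite /z unlift_none.
have zl j : z (lift ord0 j) = x j ord0 by rewrite /z liftK.
have zline l : z (@line _ _ G l).1 = z (line l).2.
  apply/eqP; rewrite -subr_eq0 -incidence_mul big_ord_recl z0 mulr0 add0r.
  move/matrixP: A0 => /(_ l ord0); rewrite mxE [RHS]mxE => A0; apply/eqP.
  by rewrite -[RHS]A0; apply: eq_bigr => j _; rewrite zl [in RHS]mxE.
pose adj i j := [exists l, (@line _ _ G l == (i, j)) || (line l == (j, i))].
have zc i j : connect adj i j -> z i = z j.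
  move=> cij; apply/eqP.
  (* The level set of [z] through [j] is closed under adjacency, hence contains every node connected
     to [j]. *)
  pose a := [pred k | z k == z j].
  have cl : fingraph.closed adj a.
    by move=> p q /existsP[l /orP[]/eqP E]; have := zline l; rewrite E/= !inE => ->.
  by have := closed_connect cl cij; rewrite !inE eqxx.
apply/matrixP => j k; rewrite ord1 mxE -zl -z0.
exact/zc/line_connected.
Qed.

Lemma red_laplacian_unit : red_laplacian G \in unitmx.
Proof.
rewrite red_laplacianE; apply: gram_unitmx incidence_inj.
exact: weight_gt0.
Qed.

End Network.

Section Split.
Variables (m d : nat) (G : network R (m + d)).

(** Linear independence of the columns of [C], drawn from connectedness: pad [v] with zeros at the
    slack and deterministic nodes, cancel the positive diagonal matrices, then use injectivity of
    the reduced incidence matrix and invertibility of the reduced Laplacian. *)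
Lemma Cmx_inj (v : 'cV[R]_m) : Cmx G *m v = 0 -> v = 0.
Proof.
move=> Cv0.
pose w : 'cV[R]_(m + d) := col_mx v 0.
have {Cv0} : Cbar G *m col_mx 0 w = 0.
  rewrite -[Cbar G]hsubmxK mul_row_col mulmx0 add0r.
  by rewrite -[rsubmx _]hsubmxK mul_row_col mulmx0 addr0.
have BE : breveB G *m col_mx 0 w = col_mx 0 (invmx (red_laplacian G) *m w).
  by rewrite /breveB (@mul_block_col _ 1 (m + d) 1 (m + d)) !mul0mx !add0r.
rewrite /Cbar -!mulmxA BE => E.
have I0 : incidence G *m (col_mx 0 (invmx (red_laplacian G) *m w) : 'cV_(1 + (m + d))) = 0.
  have LW q : Lambda G *m (Wmx G *m q) = 0 :> 'cV_(nlines G) -> q = 0.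
    move=> /matrixP q0; apply/matrixP => l j; have := q0 l j.
    rewrite /Lambda /Wmx !mul_diag_mx !mxE => /eqP.
    rewrite !mulf_eq0 invr_eq0 gt_eqF ?imax_gt0//= gt_eqF ?weight_gt0//=.
    by move/eqP.
  exact: LW.
have {}I0 : col' ord0 (incidence G) *m (invmx (red_laplacian G) *m w) = 0.
  rewrite -[RHS]I0; apply/matrixP => l j; rewrite !mxE big_ord_recl.
  have c0 (y : 'cV[R]_(m + d)) : col_mx (0 : 'cV_1) y ord0 j = 0.
    by rewrite -[ord0](_ : lshift (m + d) (ord0 : 'I_1) = _) ?col_mxEu ?mxE//; exact/val_inj.
  have c1 (y : 'cV[R]_(m + d)) k : col_mx (0 : 'cV_1) y (lift ord0 k) j = y k j.
    by rewrite -[lift ord0 k](_ : rshift 1 k = _) ?col_mxEd//; exact/val_inj.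
  rewrite c0 mulr0 add0r; apply: eq_bigr => k _.
  by rewrite [in LHS]mxE; congr (_ * _); rewrite c1.
have := incidence_inj I0 => /(congr1 (mulmx (red_laplacian G))).
rewrite mulKVmx ?red_laplacian_unit// mulmx0 => w0.
by have := congr1 usubmx w0; rewrite col_mxKu linear0.
Qed.

Lemma Cplus_Cmx : Cplus G *m Cmx G = 1%:M.
Proof.
rewrite /Cplus -mulmxA mulVmx//.
have := gram_unitmx (w := fun=> 1) (fun=> ltr01) Cmx_inj.
suff -> : diag_mx (\row_(l < nlines G) 1 : 'rV[R]_(nlines G)) = 1%:M by rewrite mulmx1.
by apply/matrixP => i j; rewrite !mxE.
Qed.

(** This makes [Lprime] nonempty, so that the minimum over its lines is attained. *)
Lemma row_Cmx_neq0 : (0 < m)%N -> exists k, row k (Cmx G) != 0.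
Proof.
move=> m0; apply/existsP; apply: contraT; rewrite negb_exists => /forallP C0.
have C00 : Cmx G = 0.
  by apply/row_matrixP => k; rewrite row0; apply/eqP; have := C0 k; rewrite negbK.
have := @Cmx_inj (const_mx 1); rewrite C00 mul0mx => /(_ erefl)/matrixP.
move=> /(_ (Ordinal m0) ord0)/eqP; by rewrite !mxE oner_eq0.
Qed.

Variables (T gamma : R) (lc : 'I_m -> R).

Lemma sigma2E (k : 'I_(nlines G)) : sigma2 lc k = \sum_i (Cmx G k i) ^+ 2 * lc i ^+ 2.
Proof.
rewrite /sigma2 /Lmx mulmx_diag mxE; apply: eq_bigr => i _.
by rewrite mul_mx_diag !mxE; ring.
Qed.

Lemma line_varE (k : 'I_(nlines G)) :
  line_var T gamma lc k = gamma^-1 * (1 - expR (- (2 * gamma * T))) * sigma2 lc k.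
Proof. by rewrite /line_var /MT -scalemxAr -scalemxAl mxE. Qed.

Lemma sigma2_gt0 (k : 'I_(nlines G)) : (forall i, 0 < lc i) ->
  row k (Cmx G) != 0 -> 0 < sigma2 lc k.
Proof.
move=> lc0 Ck; rewrite sigma2E lt0r; apply/andP; split; last first.
  by apply: sumr_ge0 => i _; rewrite mulr_ge0 ?sqr_ge0.
apply: contra_neq Ck => /eqP; rewrite psumr_eq0 => [/allP s0|i _]; last first.
  by rewrite mulr_ge0 ?sqr_ge0.
apply/matrixP => i j; rewrite mxE [RHS]mxE; apply/eqP.
have := s0 j; rewrite mem_index_enum => /(_ isT)/=.
by rewrite mulf_eq0 !sqrf_eq0 [lc j == 0]gt_eqF// orbF.
Qed.

End Split.
End NetworkAlgebra.

(** * Energy of vector paths *)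

Section VectorEnergy.
Variables (R : realType) (m : nat) (T gamma : R) (lc : 'I_m -> R).
Hypotheses (T0 : 0 < T) (gamma0 : 0 < gamma) (lc0 : forall i, 0 < lc i).
Local Notation leb := (@lebesgue_measure R).
Variables (phi : 'I_m -> R -> R) (a : 'I_m -> R).
Hypothesis Lphi : forall i, L2fun T (phi i).

Let x i t := \int[leb]_(s in `[0, t]) phi i s.
Let U i := \int[leb]_(s in `[0, T]) ((phi i s + gamma * x i s) ^+ 2).
Let E t := (expR (2 * gamma * t) - 1) / (2 * gamma).
Let e t := expR (gamma * t).
Let s2 := \sum_i a i ^+ 2 * lc i ^+ 2.

Definition OUenergy : R := \sum_i 2^-1 * ((lc i ^+ 2)^-1 * U i).

Let z t := \sum_i a i * x i t.

Let term_le i theta t : t \in `[0, T] ->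
  theta * (e t) * (a i * x i t) - theta ^+ 2 * E t / 2 * (a i ^+ 2 * lc i ^+ 2) <=
  2^-1 * ((lc i ^+ 2)^-1 * U i).
Proof.
(* The multiplier [theta * lc i ^+ 2 * a i] compensates the weight [1 / lc i ^+ 2] of the energy, so
   that the linear terms of all injections add up to [theta * e t * z t] with a single parameter
   [theta]. *)
move=> tT; have := OU_energy_ge T0 gamma0 (Lphi i) (theta * lc i ^+ 2 * a i) tT.
rewrite -/(x i t) -/(U i) -/(e t) -/(E t) => H.
have li := lc0 i.
have -> : theta * e t * (a i * x i t) - theta ^+ 2 * E t / 2 * (a i ^+ 2 * lc i ^+ 2) =
   2^-1 * ((lc i ^+ 2)^-1 * (2 * (theta * lc i ^+ 2 * a i) * (e t * x i t) - (theta * lc i ^+ 2 * a i) ^+ 2 * E t)).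
  by field; rewrite gt_eqF.
by rewrite !ler_pM2l ?invr_gt0 ?exprn_gt0.
Qed.

Lemma OUenergy_ge theta t : t \in `[0, T] ->
  theta * e t * z t - theta ^+ 2 * E t / 2 * s2 <= OUenergy.
Proof.
move=> tT; rewrite /z /s2 !mulr_sumr -sumrB.
by apply: ler_sum => i _; exact: term_le.
Qed.

Lemma OUenergy_eq theta :
  OUenergy <= theta * e T * z T - theta ^+ 2 * E T / 2 * s2 ->
  forall i t, t \in `[0, T] -> x i t = theta * lc i ^+ 2 * a i * OUshape gamma t.
Proof.
move=> le1 i t tT.
have TT : T \in `[0, T] by rewrite in_itv/= lexx ltW.
(* By [term_le] no summand of the difference is positive, while the hypothesis makes their sum
   nonnegative; hence each summand is nonnegative, and the scalar equality case applies to each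
   injection. *)
have eqi : 2^-1 * ((lc i ^+ 2)^-1 * U i) <=
   theta * (e T) * (a i * x i T) - theta ^+ 2 * E T / 2 * (a i ^+ 2 * lc i ^+ 2).
  move: le1; rewrite /z /s2 !mulr_sumr -sumrB /OUenergy -subr_ge0 -sumrB.
  rewrite (bigD1 i)//= => S0; rewrite -subr_ge0; apply: le_trans S0 _.
  rewrite gerDl; apply: sumr_le0 => j _; rewrite subr_le0; exact: term_le.
have li := lc0 i.
have := @OU_energy_eq _ _ _ _ T0 gamma0 (Lphi i) (theta * lc i ^+ 2 * a i) _ t tT.
rewrite -/(x i t) -/(x i T) -/(U i) -/(e T) -/(e t) -/(E T) -/(E t) => H.
have {}H : e t * x i t = (theta * lc i ^+ 2 * a i) * E t.
  apply: H.
  have -> : U i = 2 * lc i ^+ 2 * (2^-1 * ((lc i ^+ 2)^-1 * U i)) by field; rewrite gt_eqF.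
  apply: le_trans (ler_wpM2l _ eqi) _; first by rewrite mulr_ge0// sqr_ge0.
  by rewrite le_eqVlt; apply/orP; left; apply/eqP; field.
apply: (@mulfI _ (e t)); first by rewrite gt_eqF// expR_gt0.
by rewrite H /E -expR_OUshape; rewrite /e; ring.
Qed.

(** Twice the variance at time [t] of an Ornstein-Uhlenbeck process with unit diffusion coefficient.
    At [t = T] it is the scalar factor of [MT]; the time is a parameter because an overflow may
    occur before [T]. *)
Definition OUvar t : R := gamma^-1 * (1 - expR (- (2 * gamma * t))).

Lemma OUvarE t : OUvar t * expR (gamma * t) ^+ 2 = 2 * E t.
Proof.
rewrite /OUvar /E -expRM_natl.
have -> : 2%:R * (gamma * t) = 2 * gamma * t :> R by ring.
rewrite expRN; have := expR_gt0 (2 * gamma * t).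
by move: (expR _) => q q0; field; rewrite !gt_eqF.
Qed.

Lemma OUvar_gt0 t : 0 < t -> 0 < OUvar t.
Proof.
move=> t0; rewrite mulr_gt0 ?invr_gt0// subr_gt0 -expR0 ltr_expR oppr_lt0.
by rewrite !mulr_gt0.
Qed.

Lemma le_OUvar : {mono OUvar : s t / s <= t}.
Proof.
move=> s t; rewrite /OUvar ler_pM2l ?invr_gt0// lerD2l lerN2 ler_expR lerN2.
by rewrite ler_pM2l// mulr_gt0.
Qed.

Hypothesis s20 : 0 < s2.

Lemma OUenergy_bound t : t \in `[0, T] -> z t ^+ 2 <= OUvar t * s2 * OUenergy.
Proof.
move=> tT; have := tT; rewrite in_itv/= => /andP[]; rewrite le_eqVlt => /predU1P[<- _|t0 _].
  rewrite /z big1 => [|i _]; last by rewrite /x set_itv1 Rintegral_set1 mulr0.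
  by rewrite /OUvar mulr0 oppr0 expR0 subrr mulr0 !mul0r expr0n.
have V0 := OUvar_gt0 t0.
(* This [theta] is the vertex [e z / (E s2)] of the concave quadratic, rewritten through
   [E = OUvar * e^2 / 2]. It would divide by zero at [t = 0], where instead [z = 0]. *)
have H := OUenergy_ge (z t / (e t * OUvar t / 2 * s2)) tT.
have e0 : 0 < e t by exact: expR_gt0.
have EE : E t = OUvar t * e t ^+ 2 / 2 by rewrite OUvarE mulrAC mulfV ?mul1r.
rewrite mulrC -ler_pdivrMr ?(mulr_gt0 V0 s20)//; apply: le_trans H.
rewrite EE le_eqVlt; apply/orP; left; apply/eqP; field.
by rewrite !gt_eqF.
Qed.

Lemma OUenergy_bound_eq : OUvar T * s2 * OUenergy <= z T ^+ 2 ->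
  exists c : 'I_m -> R, forall i t, t \in `[0, T] -> x i t = c i * OUshape gamma t.
Proof.
have V0 := OUvar_gt0 T0 => H.
pose theta := z T / (e T * OUvar T / 2 * s2).
exists (fun i => theta * lc i ^+ 2 * a i); apply: OUenergy_eq.
have e0 : 0 < e T by exact: expR_gt0.
have EE : E T = OUvar T * e T ^+ 2 / 2 by rewrite OUvarE mulrAC mulfV ?mul1r.
move: H; rewrite mulrC -ler_pdivlMr ?(mulr_gt0 V0 s20)// => /le_trans; apply.
rewrite EE le_eqVlt; apply/orP; left; apply/eqP; rewrite /theta; field.
by rewrite !gt_eqF.
Qed.

End VectorEnergy.

(** [OUshape] saturates the energy bound: its energy for unit diffusion, times [OUvar], is its
    squared value at time [t]. *)
Lemma OUvar_OUshape (R : realType) (gamma t : R) : 0 < gamma ->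
  2^-1 * ((expR (2 * gamma * t) - 1) / (2 * gamma)) * OUvar gamma t = OUshape gamma t ^+ 2.
Proof.
move=> g0; have g1 : gamma != 0 by rewrite gt_eqF.
have e0 : 0 < expR (gamma * t) by exact: expR_gt0.
apply: (@mulIf _ (expR (gamma * t) ^+ 2)); first by rewrite gt_eqF// exprn_gt0.
rewrite -[LHS]mulrA OUvarE//.
have -> : OUshape gamma t ^+ 2 * expR (gamma * t) ^+ 2 = (expR (gamma * t) * OUshape gamma t) ^+ 2 by ring.
by rewrite expR_OUshape; field.
Qed.

(** * One-sided derivatives of the extremal paths at [0] and [T] *)

Section EndpointDerivative.
Variables (R : realType) (T gamma : R).
Hypotheses (T0 : 0 < T) (gamma0 : 0 < gamma).

Lemma shape_quotient (F : R -> R) p q t h :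
  (forall s, s \in `[0, T] -> F s = p + q * OUshape gamma s) ->
  t \in `[0, T] -> t + h \in `[0, T] ->
  h^-1 * (F (t + h) - F t) = q * (h^-1 * (OUshape gamma (t + h) - OUshape gamma t)).
Proof. by move=> FE tT hT; rewrite !FE//; ring. Qed.

Lemma OUshape_quotient (t : R) :
  h^-1 * (OUshape gamma (t + h) - OUshape gamma t) @[h --> 0^'] --> OUshape' gamma t.
Proof.
have [/cvg_ex[l lH] <-] := is_derive_OUshape gamma0 t.
have E : (fun h => h^-1 *: ((OUshape gamma \o shift t) (h *: (1 : R)) - OUshape gamma t)) =
         (fun h => h^-1 * (OUshape gamma (t + h) - OUshape gamma t)).
  by apply/funext => h /=; rewrite /shift/= /GRing.scale/= mulr1 [h + t]addrC.
by rewrite /derive; rewrite E in lH *; rewrite (cvg_lim _ lH).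
Qed.

Lemma shape_quotient_at_right (F : R -> R) p q :
  (forall s, s \in `[0, T] -> F s = p + q * OUshape gamma s) ->
  h^-1 * (F (0 + h) - F 0) @[h --> 0^'+] --> q * OUshape' gamma 0.
Proof.
move=> FE; have TT : 0 \in `[0, T] by rewrite in_itv/= lexx ltW.
have : q * (h^-1 * (OUshape gamma (0 + h) - OUshape gamma 0)) @[h --> 0^'+] --> q * OUshape' gamma 0.
  by apply: cvgM; [exact: cvg_cst|apply: cvg_dnbhs_at_right; exact: OUshape_quotient].
apply: cvg_trans; apply: near_eq_cvg; near=> h.
rewrite (shape_quotient FE)//.
rewrite add0r in_itv/=; apply/andP; split; apply/ltW; near: h.
  exact: nbhs_right_gt.
exact: nbhs_right_lt.
Unshelve. all: by end_near. Qed.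

Lemma shape_quotient_at_left (F : R -> R) p q :
  (forall s, s \in `[0, T] -> F s = p + q * OUshape gamma s) ->
  h^-1 * (F (T + h) - F T) @[h --> 0^'-] --> q * OUshape' gamma T.
Proof.
move=> FE; have TT : T \in `[0, T] by rewrite in_itv/= lexx ltW.
have : q * (h^-1 * (OUshape gamma (T + h) - OUshape gamma T)) @[h --> 0^'-] --> q * OUshape' gamma T.
  by apply: cvgM; [exact: cvg_cst|apply: cvg_dnbhs_at_left; exact: OUshape_quotient].
apply: cvg_trans; apply: near_eq_cvg; near=> h.
rewrite (shape_quotient FE)//.
have h0 : h < 0 by near: h; exact: nbhs_left_lt.
have hT : - T < h by near: h; apply: nbhs_left_gt; rewrite oppr_lt0.
rewrite in_itv/=; apply/andP; split; lra.
Unshelve. all: by end_near. Qed.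

End EndpointDerivative.

(** * Current paths *)

Section CurrentPaths.
Variables (R : realType) (m d : nat) (G : network R (m + d)) (T gamma : R).
Hypotheses (T0 : 0 < T) (gamma0 : 0 < gamma).
Variables (lc : 'I_m -> R) (mubar : 'cV[R]_(m + d)) (b l : 'I_m -> R -> R).
Hypothesis lc0 : forall i, 0 < lc i.
Hypothesis hb : forall i x, b i x = gamma * (usubmx mubar i ord0 - x).
Hypothesis hl : forall i x, l i x = lc i.
Local Notation leb := (@lebesgue_measure R).
Local Notation C := (Cmx G).
Local Notation mu := (usubmx mubar).
Local Notation y := (det_current G mubar).
Local Notation prim phi := (fun i t => \int[leb]_(s in `[0, t]) phi s i ord0).

Lemma Cplus_affine (x : 'cV[R]_m) : Cplus G *m (y + C *m x - y) = x.
Proof. by rewrite addrAC subrr add0r mulmxA Cplus_Cmx mul1mx. Qed.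

Lemma Icur_ge (f : R -> 'cV[R]_(nlines G)) (g phi : R -> 'cV[R]_m) :
  (forall i, L2fun T (fun s => phi s i ord0)) ->
  (forall t : R, t \in `[0, T] -> forall i,
     g t i ord0 = mu i ord0 + \int[leb]_(s in `[0, t]) phi s i ord0) ->
  (forall t : R, t \in `[0, T] -> f t = y + C *m g t) ->
  ((OUenergy T gamma lc (fun i s => phi s i ord0))%:E <= Icur T b l mubar f)%E.
Proof.
move=> Lphi gE fE; rewrite /Icur /Ipow /OUenergy -sumEFin.
apply: lee_sum => i _; rewrite EFinM; apply: lee_wpmul2l; first by rewrite lee_fin invr_ge0.
have H := @OU_cost_ge _ _ gamma T0 (fun s => phi s i ord0)
  (fun s => (Cplus G *m (f s - y)) i ord0) (mu i ord0) _ (lc0 i) (Lphi i).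
apply: le_trans (H _) _ => [t tT|]; first by rewrite fE// Cplus_affine gE.
rewrite le_eqVlt; apply/orP; left; apply/eqP; apply: eq_integral => t _.
by rewrite hb hl.
Qed.

Lemma path_entry (f : R -> 'cV[R]_(nlines G)) (g phi : R -> 'cV[R]_m) k t :
  (forall t : R, t \in `[0, T] -> forall i,
     g t i ord0 = mu i ord0 + \int[leb]_(s in `[0, t]) phi s i ord0) ->
  (forall t : R, t \in `[0, T] -> f t = y + C *m g t) -> t \in `[0, T] ->
  f t k ord0 = nu G mubar k ord0 + \sum_i C k i * prim phi i t.
Proof.
move=> gE fE tT; rewrite fE//.
have -> : g t = mu + \col_i prim phi i t.
  by apply/matrixP => i j; rewrite ord1 gE// !mxE.
rewrite mulmxDr addrA [y + _]addrC -/(nu G mubar) mxE; congr (_ + _).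
by rewrite mxE; apply: eq_bigr => i _; rewrite [X in _ * X]mxE.
Qed.

(** Each entry is continuous on [[0, T]], so its absolute value attains a maximum. This both bounds
    the set behind [sup_norm] and turns a supremum at least [1] into an actual time and line. *)
Lemma path_entry_max (f : R -> 'cV[R]_(nlines G)) : cur_paths T mubar f ->
  forall k, exists tk, tk \in `[0, T] /\
    forall t, t \in `[0, T] -> `|f t k ord0| <= `|f tk k ord0|.
Proof.
move=> [g [phi Lphi gE] fE] k.
pose F t := `|nu G mubar k ord0 + \sum_i C k i * prim phi i t|.
have FE t : t \in `[0, T] -> `|f t k ord0| = F t.
  by move=> tT; rewrite (path_entry k gE fE).
have cF : {within `[0, T], continuous F}.
  move=> s; apply: cvg_norm; apply: cvgD; first exact: cvg_cst.
  apply: cvg_big => [|i _]; first exact: add_continuous.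
  by apply: cvgM; [exact: cvg_cst|exact: (L2fun_primitive_continuous T0 (Lphi i))].
have [tk tkT tkmax] := EVT_max (ltW T0) cF.
by exists tk; split => // t tT; rewrite !FE// tkmax.
Qed.

Lemma overflow_attained (f : R -> 'cV[R]_(nlines G)) :
  cur_paths T mubar f -> 1 <= sup_norm T f ->
  exists2 t, t \in `[0, T] & exists k, 1 <= `|f t k ord0|.
Proof.
move=> cf f1; apply: contrapT => nf.
have lt1 t k : t \in `[0, T] -> `|f t k ord0| < 1.
  by move=> tT; rewrite ltNge; apply/negP => fk; apply: nf; exists t => //; exists k.
have [tk tkP] := choice (path_entry_max cf).
have : sup_norm T f <= \big[Num.max/0]_k `|f (tk k) k ord0|.
  apply: ge_sup.
    by exists (\big[Num.max/0]_k `|f 0 k ord0|), 0 => //=; rewrite in_itv/= lexx ltW.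
  move=> _ [t tT <-]; apply: bigmax_le => [|k _].
    by apply: bigmax_ge_id.
  by apply: le_trans (le_bigmax _ (fun k => `|f (tk k) k ord0|) k); have [_] := tkP k; apply.
move=> /(le_trans f1); apply/negP; rewrite -ltNge.
by apply: bigmax_lt => // k _; apply: lt1; case: (tkP k).
Qed.

Definition shape_path (c : 'cV[R]_m) (t : R) : 'cV[R]_(nlines G) :=
  y + C *m (mu + OUshape gamma t *: c).

Definition shape_cost (c : 'cV[R]_m) : R :=
  \sum_i 2^-1 * ((c i ord0 / lc i) ^+ 2 * ((expR (2 * gamma * T) - 1) / (2 * gamma))).

Lemma shape_path_cur c : cur_paths T mubar (shape_path c).
Proof.
exists (fun t => mu + OUshape gamma t *: c) => //.
exists (fun s => OUshape' gamma s *: c) => [i|t tT i].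
  apply: continuous_L2fun; apply: continuous_subspaceT => s.
  rewrite (_ : (fun _ => _) = (fun s => OUshape' gamma s * c i ord0)); last first.
    by apply/funext => ?; rewrite mxE.
  by apply: cvgM; [exact: OUshape'_continuous|exact: cvg_cst].
have t0 : 0 <= t by move: tT; rewrite in_itv/= => /andP[].
rewrite !mxE; congr (_ + _); rewrite mulrC -(Rintegral_OUshape' gamma0)//.
by apply: eq_Rintegral => s _; rewrite mxE mulrC.
Qed.

Section Shape.
Variables (c : 'cV[R]_m) (f : R -> 'cV[R]_(nlines G)).
Hypothesis fE : forall t, t \in `[0, T] -> f t = shape_path c t.

Lemma shape_injection i t : t \in `[0, T] ->
  (Cplus G *m (f t - y)) i ord0 = mu i ord0 + c i ord0 * OUshape gamma t.
Proof. by move=> tT; rewrite fE// Cplus_affine mxE [X in _ + X]mxE mulrC. Qed.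

Lemma shape_entry k t : t \in `[0, T] ->
  f t k ord0 = nu G mubar k ord0 + (C *m c) k ord0 * OUshape gamma t.
Proof.
move=> tT; rewrite fE// /shape_path mulmxDr -scalemxAr /nu addrA [y + _]addrC.
by rewrite mxE [X in _ + X]mxE mulrC.
Qed.

Lemma Icur_shape : Icur T b l mubar f = (shape_cost c)%:E.
Proof.
rewrite /Icur /Ipow /shape_cost -sumEFin; apply: eq_bigr => i _.
rewrite EFinM; congr (_ * _)%E.
rewrite -(OU_cost_shape T0 gamma0 (lc0 i)
  (G := fun s => (Cplus G *m (f s - y)) i ord0) (mu := mu i ord0)); last first.
  by move=> t tT; exact: shape_injection.
by apply: eq_integral => t _; rewrite hb hl.
Qed.

Lemma shape_endpoint_derivable : endpoint_derivable T f.
Proof.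
move=> k; split.
  apply/cvg_ex; exists ((C *m c) k ord0 * OUshape' gamma 0).
  exact: (shape_quotient_at_right T0 gamma0 (shape_entry k)).
apply/cvg_ex; exists ((C *m c) k ord0 * OUshape' gamma T).
exact: (shape_quotient_at_left T0 gamma0 (shape_entry k)).
Qed.

Lemma shape_rderive : rderive f 0 = C *m (OUshape' gamma 0 *: c).
Proof.
apply/matrixP => k j; rewrite ord1 mxE -scalemxAr [RHS]mxE mulrC.
apply: cvg_lim => //.
exact: (shape_quotient_at_right T0 gamma0 (shape_entry k)).
Qed.

Lemma shape_lderive : lderive f T = C *m (OUshape' gamma T *: c).
Proof.
apply/matrixP => k j; rewrite ord1 mxE -scalemxAr [RHS]mxE mulrC.
apply: cvg_lim => //.
exact: (shape_quotient_at_left T0 gamma0 (shape_entry k)).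
Qed.

Lemma shape_Kcost i t : t \in `[0, T] ->
  Kcost b l mubar i (f t) (C *m (OUshape' gamma t *: c)) =
  2^-1 * ((c i ord0 / lc i) ^+ 2 * expR (2 * gamma * t)).
Proof.
move=> tT; rewrite /Kcost shape_injection// hb hl mulmxA Cplus_Cmx mul1mx mxE.
have -> : expR (2 * gamma * t) = expR (gamma * t) ^+ 2.
  by rewrite -expRM_natl; congr expR; ring.
rewrite -(OUshapeE gamma0); have := lc0 i => li; field.
by rewrite gt_eqF.
Qed.

(** By [shape_Kcost], the endpoint increment of the [i]-th running cost is
    [(c i / lc i)^2 (e^(2 gamma T) - 1) / 2], and dividing it by [2 gamma] gives the [i]-th term of
    [shape_cost]. *)
Lemma Phi_shape : Phi T b l mubar f = 2 * gamma * shape_cost c.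
Proof.
rewrite /Phi /shape_cost mulr_sumr; apply: eq_bigr => i _.
rewrite shape_rderive shape_lderive !shape_Kcost ?in_itv/= ?lexx ?ltW//.
by rewrite mulr0 expR0; field; rewrite !gt_eqF.
Qed.

End Shape.

Hypothesis adm : admissible G mubar.
Local Notation a k := (1 - `|nu G mubar k ord0|).
Local Notation V k := (line_var T gamma lc k).

Let V_E (k : 'I_(nlines G)) : V k = OUvar gamma T * sigma2 lc k.
Proof. exact: line_varE. Qed.

Let a_ge0 k : 0 <= a k. Proof. by rewrite subr_ge0; have [] := adm. Qed.

Lemma line_var_gt0 (k : 'I_(nlines G)) : row k C != 0 -> 0 < V k.
Proof. by move=> Ck; rewrite V_E mulr_gt0 ?OUvar_gt0 ?sigma2_gt0. Qed.

Lemma overflow_line (f : R -> 'cV[R]_(nlines G)) (g phi : R -> 'cV[R]_m) :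
  (forall i, L2fun T (fun s => phi s i ord0)) ->
  (forall t : R, t \in `[0, T] -> forall i,
     g t i ord0 = mu i ord0 + \int[leb]_(s in `[0, t]) phi s i ord0) ->
  (forall t : R, t \in `[0, T] -> f t = y + C *m g t) -> 1 <= sup_norm T f ->
  exists2 t, t \in `[0, T] & exists2 k, row k C != 0 &
    a k ^+ 2 <= (\sum_i C k i * prim phi i t) ^+ 2.
Proof.
move=> Lphi gE fE f1.
have cf : cur_paths T mubar f by exists g => //; exists phi.
have [t tT [k fk]] := overflow_attained cf f1.
exists t => //; exists k.
  (* A zero row keeps the current of line [k] at [nu k], which admissibility places strictly below
     capacity; so the overflowing line belongs to [Lprime]. *)
  apply/negP => Ck; have := adm.2 k; rewrite /Lprime/= Ck => /(_ (negP (isT : ~~ false))).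
  rewrite ltNge => /negP; apply; move: fk; rewrite (path_entry k gE fE)//.
  rewrite big1 ?addr0// => i _.
  by move/eqP/matrixP: Ck => /(_ ord0 i); rewrite mxE [RHS]mxE => ->; rewrite mul0r.
move: fk; rewrite (path_entry k gE fE)// => fk.
rewrite -[leRHS](real_normK (num_real _)) lerXn2r ?nnegrE//.
rewrite lerBlDl; exact: le_trans fk (ler_normD _ _).
Qed.

Lemma overflow_cost_ge (f : R -> 'cV[R]_(nlines G)) : overflow_paths T mubar f ->
  exists2 k, row k C != 0 & ((a k ^+ 2 / V k)%:E <= Icur T b l mubar f)%E.
Proof.
move=> [[g [phi Lphi gE] fE] f1].
have [t tT [k Ck ak]] := overflow_line Lphi gE fE f1.
exists k => //; apply: le_trans (Icur_ge Lphi gE fE); rewrite lee_fin.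
have s0 : 0 < \sum_i C k i ^+ 2 * lc i ^+ 2 by rewrite -sigma2E sigma2_gt0.
have H := OUenergy_bound T0 gamma0 lc0 Lphi s0 tT.
have J0 : 0 <= OUenergy T gamma lc (fun i s => phi s i ord0).
  apply: sumr_ge0 => i _; rewrite mulr_ge0 ?invr_ge0// mulr_ge0 ?invr_ge0 ?sqr_ge0//.
  by apply: Rintegral_ge0 => s _; exact: sqr_ge0.
rewrite ler_pdivrMr ?line_var_gt0// mulrC V_E sigma2E.
apply: le_trans ak (le_trans H _).
apply: ler_wpM2r => //; apply: ler_wpM2r; first exact: ltW.
by rewrite le_OUvar//; move: tT; rewrite in_itv/= => /andP[].
Qed.

(** With [J] the energy and [z] the displacement of the overflowing line, [OUvar T * s2 * J <= a^2
    <= z(t)^2 <= OUvar t * s2 * J]. For [J > 0] and increasing [OUvar] this forces [t = T] and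
    equality throughout, so the path is a sinh path. *)
Lemma cheap_overflow_shape (f : R -> 'cV[R]_(nlines G)) : overflow_paths T mubar f ->
  (forall k, row k C != 0 -> (Icur T b l mubar f <= (a k ^+ 2 / V k)%:E)%E) ->
  exists c, forall t, t \in `[0, T] -> f t = shape_path c t.
Proof.
move=> [[g [phi Lphi gE] fE] f1] cheap.
have [t tT [k Ck ak]] := overflow_line Lphi gE fE f1.
have s0 : 0 < \sum_i C k i ^+ 2 * lc i ^+ 2 by rewrite -sigma2E sigma2_gt0.
have H := OUenergy_bound T0 gamma0 lc0 Lphi s0 tT.
have := le_trans (Icur_ge Lphi gE fE) (cheap k Ck).
rewrite lee_fin ler_pdivlMr ?line_var_gt0// mulrC V_E sigma2E => JV.
have VT0 : 0 < OUvar gamma T by exact: OUvar_gt0.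
suff bnd : OUvar gamma T * (\sum_i C k i ^+ 2 * lc i ^+ 2) *
    OUenergy T gamma lc (fun i s => phi s i ord0) <= (\sum_i C k i * prim phi i T) ^+ 2.
  have [c cE] := OUenergy_bound_eq T0 gamma0 lc0 Lphi s0 bnd.
  exists (\col_i c i) => s sT; rewrite fE// /shape_path; congr (_ + _ *m _).
  by apply/matrixP => i j; rewrite ord1 gE// cE// !mxE mulrC.
apply: (le_trans JV).
(* A line starting at capacity may overflow at any time, but then the left side of the chain is at
   most zero, and the equality case holds at [T] all the same. *)
have [a0|a0] := eqVneq (a k) 0; first by rewrite a0 expr0n/= sqr_ge0.
suff -> : T = t by [].
apply/eqP; rewrite eq_le; apply/andP; split; last by move: tT; rewrite in_itv/= => /andP[].
rewrite -(le_OUvar gamma0).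
have a20 : 0 < a k ^+ 2 by rewrite exprn_gt0// lt0r a0 a_ge0.
set J := OUenergy _ _ _ _ in H JV; set s2 := (X in _ * X * _) in H JV.
have Vs0 : 0 < OUvar gamma T * s2 by rewrite mulr_gt0.
have : OUvar gamma T * s2 * J <= OUvar gamma t * s2 * J.
  exact: le_trans JV (le_trans ak H).
have J0 : 0 < J.
  rewrite lt0r; apply/andP; split.
    apply: contraTneq (le_trans ak H) => ->; rewrite mulr0 -ltNge//.
  apply: sumr_ge0 => i _; rewrite mulr_ge0 ?invr_ge0// mulr_ge0 ?invr_ge0 ?sqr_ge0//.
  by apply: Rintegral_ge0 => s _; exact: sqr_ge0.
by rewrite ler_pM2r// ler_pM2r.
Qed.

(** The direction [c] proportional to [L^2 C_k^T] is the one found in the equality case. The path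
    brings line [k] to capacity at [T]; the other lines are unconstrained, since overflow only
    bounds the norm from below. *)
Lemma overflow_shape_ex (k : 'I_(nlines G)) : row k C != 0 ->
  exists2 f : R -> 'cV[R]_(nlines G), overflow_paths T mubar f &
    Icur T b l mubar f = (a k ^+ 2 / V k)%:E.
Proof.
move=> Ck; have Vk := line_var_gt0 Ck; have sk := sigma2_gt0 lc0 Ck.
have TT : T \in `[0, T] by rewrite in_itv/= lexx ltW.
have VT0 : 0 < OUvar gamma T by exact: OUvar_gt0.
have E0 : 0 < (expR (2 * gamma * T) - 1) / (2 * gamma).
  by rewrite divr_gt0 ?mulr_gt0// subr_gt0 -expR0 ltr_expR !mulr_gt0.
have S2 : OUshape gamma T ^+ 2 != 0.
  by rewrite -OUvar_OUshape// gt_eqF// mulr_gt0// mulr_gt0// invr_gt0.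
have S0 : OUshape gamma T != 0 by move: S2; rewrite sqrf_eq0.
pose s : R := if 0 <= nu G mubar k ord0 then 1 else -1.
have s2 : s ^+ 2 = 1 by rewrite /s; case: ifP => _; rewrite ?sqrrN expr1n.
have sn : s * `|nu G mubar k ord0| = nu G mubar k ord0.
  rewrite /s; case: ifPn => [n0|]; first by rewrite mul1r ger0_norm.
  by rewrite -ltNge => n0; rewrite mulN1r ltr0_norm// opprK.
(* Chosen so that line [k] moves by [s * a k] up to time [T], from [nu k] to the nearest of the
   capacities [1] and [-1], namely [s]. *)
pose theta := s * a k / (sigma2 lc k * OUshape gamma T).
pose c : 'cV[R]_m := \col_i (theta * lc i ^+ 2 * C k i).
have Cc : (C *m c) k ord0 = theta * sigma2 lc k.
  by rewrite mxE sigma2E mulr_sumr; apply: eq_bigr => i _; rewrite [c i ord0]mxE; ring.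
exists (shape_path c); last first.
  rewrite (@Icur_shape c)//; congr EFin.
  have -> : shape_cost c = 2^-1 * ((expR (2 * gamma * T) - 1) / (2 * gamma)) * (theta ^+ 2 * sigma2 lc k).
    rewrite /shape_cost sigma2E !mulr_sumr; apply: eq_bigr => i _; rewrite [c i ord0]mxE.
    by have := lc0 i => li; field; rewrite !gt_eqF.
  have -> : theta ^+ 2 * sigma2 lc k = a k ^+ 2 / (sigma2 lc k * OUshape gamma T ^+ 2).
    have -> : theta ^+ 2 = s ^+ 2 * (a k ^+ 2 / (sigma2 lc k ^+ 2 * OUshape gamma T ^+ 2)).
      by rewrite /theta; field; rewrite S0 gt_eqF.
    by rewrite s2; field; rewrite S0 gt_eqF.
  rewrite -OUvar_OUshape// V_E; field.
  have e1 : 0 < expR (2 * gamma * T) - 1 by rewrite subr_gt0 -expR0 ltr_expR !mulr_gt0.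
  by rewrite (gt_eqF sk) (gt_eqF VT0) (gt_eqF gamma0) (gt_eqF e1).
split; first exact: shape_path_cur.
have fT : shape_path c T k ord0 = s.
  rewrite (@shape_entry c)// Cc.
  have -> : theta * sigma2 lc k * OUshape gamma T = s * a k.
    by rewrite /theta; field; rewrite S0 gt_eqF.
  by rewrite mulrBr mulr1 sn addrC subrK.
have [tk tkP] := choice (path_entry_max (shape_path_cur c)).
apply: le_trans (ub_le_sup (x := \big[Num.max/0]_(l < nlines G) `|shape_path c T l ord0|) _ _).
- apply: le_trans (le_bigmax _ (fun l => `|shape_path c T l ord0|) k).
  by rewrite fT -[leRHS](sqrtr_sqr) s2 sqrtr1.
- exists (\big[Num.max/0]_(l < nlines G) `|shape_path c (tk l) l ord0|).
  move=> _ [t tT <-]; apply: bigmax_le => [|j _]; first exact: bigmax_ge_id.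
  by apply: le_trans (le_bigmax _ (fun l => `|shape_path c (tk l) l ord0|) j); have [_] := tkP j; apply.
- by exists T.
Qed.

End CurrentPaths.

(** * Optimal overflow paths *)

Section MinimalOverflow.
Variables (R : realType) (m d : nat) (G : network R (m + d)) (T gamma : R).
Hypotheses (m0 : (0 < m)%N) (T0 : 0 < T) (gamma0 : 0 < gamma).
Variables (lc : 'I_m -> R) (mubar : 'cV[R]_(m + d)) (b l : 'I_m -> R -> R).
Hypothesis lc0 : forall i, 0 < lc i.
Hypothesis hb : forall i x, b i x = gamma * (usubmx mubar i ord0 - x).
Hypothesis hl : forall i x, l i x = lc i.
Hypothesis adm : admissible G mubar.

Definition line_cost (k : 'I_(nlines G)) : R :=
  (1 - `|nu G mubar k ord0|) ^+ 2 / line_var T gamma lc k.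

Lemma line_cost_min : exists2 k, row k (Cmx G) != 0 &
  forall j, row j (Cmx G) != 0 -> line_cost k <= line_cost j.
Proof.
have [k0 Ck0] := row_Cmx_neq0 G m0.
by case: (@arg_minP _ _ _ k0 (fun k => row k (Cmx G) != 0) line_cost Ck0) => k Ck kmin; exists k.
Qed.

Lemma optimal_path_ex : exists f : R -> 'cV[R]_(nlines G), optimal_path T b l mubar f.
Proof.
have [k Ck kmin] := line_cost_min.
have [f fo fk] := overflow_shape_ex T0 gamma0 lc0 hb hl Ck.
exists f; split => // h ho.
have [j Cj] := overflow_cost_ge T0 gamma0 lc0 hb hl adm ho.
by apply: le_trans; rewrite fk lee_fin; exact: kmin.
Qed.

Lemma Icur_star_min k : row k (Cmx G) != 0 ->
  (forall j, row j (Cmx G) != 0 -> line_cost k <= line_cost j) ->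
  Icur_star G T b l mubar = (line_cost k)%:E.
Proof.
move=> Ck kmin; apply/eqP; rewrite eq_le; apply/andP; split.
  have [f fo <-] := overflow_shape_ex T0 gamma0 lc0 hb hl Ck.
  by apply: ereal_inf_lbound; exists f.
apply: le_ereal_inf_tmp => _ [h ho <-].
have [j Cj] := overflow_cost_ge T0 gamma0 lc0 hb hl adm ho.
by apply: le_trans; rewrite lee_fin; exact: kmin.
Qed.

Lemma bigmin_line_cost k : row k (Cmx G) != 0 ->
  (forall j, row j (Cmx G) != 0 -> line_cost k <= line_cost j) ->
  \big[Order.min/+oo%E]_(j < nlines G | row j (Cmx G) != 0) (line_cost j)%:E =
  (line_cost k)%:E.
Proof.
move=> Ck kmin; apply/eqP; rewrite eq_le; apply/andP; split.
  exact: (bigmin_le_cond _ (fun j => (line_cost j)%:E)).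
by apply: le_bigmin => [|j Cj]; rewrite ?leey// lee_fin kmin.
Qed.

Lemma optimal_path_shape (f : R -> 'cV[R]_(nlines G)) : optimal_path T b l mubar f ->
  Icur T b l mubar f = Icur_star G T b l mubar /\
  exists c, forall t, t \in `[0, T] -> f t = shape_path G gamma mubar c t.
Proof.
move=> [fo fopt]; have [k Ck kmin] := line_cost_min.
have IE : Icur T b l mubar f = Icur_star G T b l mubar.
  apply/eqP; rewrite eq_le; apply/andP; split.
    by apply: le_ereal_inf_tmp => _ [h ho <-]; exact: fopt.
  by apply: ereal_inf_lbound; exists f.
split => //; apply: (cheap_overflow_shape T0 gamma0 lc0 hb hl adm fo) => j Cj.
by rewrite IE (Icur_star_min Ck kmin) lee_fin; exact: kmin.
Qed.

Lemma optimal_path_endpoint_derivable (f : R -> 'cV[R]_(nlines G)) :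
  optimal_path T b l mubar f -> endpoint_derivable T f.
Proof. by move=> /optimal_path_shape[_ [c fE]]; exact: shape_endpoint_derivable fE. Qed.

Lemma I_TL_optimal (tau0 : R) (f : R -> 'cV[R]_(nlines G)) :
  optimal_path T b l mubar f ->
  I_TL T b l tau0 mubar f = ((1 + 2 * tau0 * gamma)%:E * Icur_star G T b l mubar)%E.
Proof.
move=> /optimal_path_shape[IE [c fE]].
rewrite /I_TL -IE (Icur_shape T0 gamma0 lc0 hb hl fE) (Phi_shape T0 gamma0 lc0 hb hl fE).
by rewrite -EFinM -EFinD; congr EFin; ring.
Qed.

(** Since [line_var] is [gamma^-1 (1 - e^(-2 gamma T))] times [sigma2], [eta^2] equals [- eps ln p]
    times [line_var]. Admissibility gives [1 - |nu k| >= 0], so both sides can be squared. *)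
Lemma line_cost_threshold (w eps p : R) k : 0 < w -> 0 < eps -> 0 < p < 1 ->
  row k (Cmx G) != 0 ->
  (- eps * ln p <= w * line_cost k) =
  (`|nu G mubar k ord0| <= 1 - eta T gamma lc eps p k / Num.sqrt w).
Proof.
move=> w0 eps0 /andP[p0 p1] Ck.
have Vk := line_var_gt0 T0 gamma0 lc0 Ck.
have lnp : 0 <= - ln p by rewrite oppr_ge0 ln_le0// ltW.
have a0 : 0 <= 1 - `|nu G mubar k ord0| by rewrite subr_ge0; have [] := adm.
have -> : eta T gamma lc eps p k = Num.sqrt (eps * - ln p * line_var T gamma lc k).
  by rewrite /eta div1r lnV ?posrE// line_varE; congr Num.sqrt; field; rewrite gt_eqF.
have X0 : 0 <= eps * - ln p * line_var T gamma lc k.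
  by apply: mulr_ge0; [apply: mulr_ge0 => //; exact: ltW|exact: ltW].
rewrite lerBrDr -lerBrDl -[RHS](@ler_pXn2r _ 2)// ?nnegrE ?divr_ge0 ?sqrtr_ge0//.
rewrite expr_div_n (sqr_sqrtr X0) (sqr_sqrtr (ltW w0)) ler_pdivrMr// /line_cost mulrA ler_pdivlMr//.
by rewrite mulNr mulrN [w * _]mulrC.
Qed.

End MinimalOverflow.

Theorem mainTheorem10 (R : realType) (m d : nat) (hm : (0 < m)%N)
    (G : network R (m + d)) (T : R) (hT : 0 < T)
    (gamma : R) (hgamma : 0 < gamma)
    (lc : 'I_m -> R) (hlc : forall i, 0 < lc i)
    (b l : 'cV[R]_m -> 'I_m -> R -> R)
    (hb : forall mu i x, b mu i x = gamma * (mu i ord0 - x))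
    (hl : forall mu i x, l mu i x = lc i)
    (tau0 : R) (htau0 : 0 < tau0) :
  (exists fstar, optimal_choice G T b l fstar) /\
  forall fstar : 'cV[R]_(m + d) -> R -> 'cV[R]_(nlines G),
    optimal_choice G T b l fstar ->
    (forall mubar, admissible G mubar ->
       let Istar := Icur_star G T (b (usubmx mubar)) (l (usubmx mubar)) mubar in
       [/\ endpoint_derivable T (fstar mubar),
           I_TL T (b (usubmx mubar)) (l (usubmx mubar)) tau0 mubar
                (fstar mubar)
             = ((1 + 2 * tau0 * gamma)%:E * Istar)%E &
           ((1 + 2 * tau0 * gamma)%:E * Istar)%E
             = ((1 + 2 * tau0 * gamma)%:E *
                \big[Order.min/+oo]_(k < nlines G | row k (Cmx G) != 0%R)
                  (((1 - `|nu G mubar k ord0|) ^+ 2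
                     / line_var T gamma lc k)%:E))%E]) /\
    (forall eps p : R, 0 < eps -> 0 < p < 1 ->
       region_TL G T b l fstar tau0 eps p =
       \bigcap_(k in Lprime G)
         [set mubar | admissible G mubar /\
            `|nu G mubar k ord0|
              <= 1 - eta T gamma lc eps p k
                     / Num.sqrt (1 + 2 * tau0 * gamma)]).
Proof.
have w0 : 0 < 1 + 2 * tau0 * gamma by rewrite addr_gt0// !mulr_gt0.
split.
  have ex mubar : exists f : R -> 'cV[R]_(nlines G), admissible G mubar ->
      optimal_path T (b (usubmx mubar)) (l (usubmx mubar)) mubar f.
    (* A choice function must be total; the zero path is a dummy value at starting points that are
       not admissible. *)
    have [adm|nadm] := pselect (admissible G mubar); last by exists (fun=> 0).
    have [f fopt] := optimal_path_ex hm hT hgamma hlc (hb (usubmx mubar)) (hl (usubmx mubar)) adm.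
    by exists f.
  by have [fstar fP] := choice ex; exists fstar.
move=> fstar fopt; split => [mubar adm Istar|eps p eps0 p01].
  have [k Ck kmin] := line_cost_min G T gamma hm lc mubar.
  split.
  - exact: (optimal_path_endpoint_derivable hm hT hgamma hlc (hb (usubmx mubar)) (hl (usubmx mubar)) adm (fopt _ adm)).
  - exact: (I_TL_optimal hm hT hgamma hlc (hb (usubmx mubar)) (hl (usubmx mubar)) adm _ (fopt _ adm)).
  - rewrite /Istar (Icur_star_min hT hgamma hlc (hb (usubmx mubar)) (hl (usubmx mubar)) adm Ck kmin).
    by rewrite (bigmin_line_cost Ck kmin).
have ITL mubar (adm : admissible G mubar) k : row k (Cmx G) != 0 ->
    (forall j, row j (Cmx G) != 0 -> line_cost T gamma lc mubar k <= line_cost T gamma lc mubar j) ->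
    I_TL T (b (usubmx mubar)) (l (usubmx mubar)) tau0 mubar (fstar mubar) =
    ((1 + 2 * tau0 * gamma) * line_cost T gamma lc mubar k)%:E.
  move=> Ck kmin.
  rewrite (I_TL_optimal hm hT hgamma hlc (hb (usubmx mubar)) (hl (usubmx mubar)) adm _ (fopt _ adm)).
  by rewrite (Icur_star_min hT hgamma hlc (hb (usubmx mubar)) (hl (usubmx mubar)) adm Ck kmin) EFinM.
apply/seteqP; split => mubar /=.
  move=> [adm reg] j Cj; split => //.
  have [k Ck kmin] := line_cost_min G T gamma hm lc mubar.
  move: reg; rewrite (ITL _ adm k Ck kmin) lee_fin => reg.
  rewrite -(line_cost_threshold hT hgamma hlc adm w0 eps0 p01 Cj).
  by apply: le_trans reg _; rewrite ler_pM2l// kmin.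
(* Membership in the intersection is used only at a line of minimal cost, which supplies
   admissibility as well as the threshold. *)
move=> reg; have [k Ck kmin] := line_cost_min G T gamma hm lc mubar.
have [adm regk] := reg k Ck; split => //.
rewrite (ITL _ adm k Ck kmin) lee_fin.
by rewrite (line_cost_threshold hT hgamma hlc adm w0 eps0 p01 Ck).
Qed.
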